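(* There is an absolute constant $c>0$ (independent of $n$ and $K$) such that for every $n\ge 1$ and every convex body $K\subset\mathbb{R}^n$ with barycenter at the origin there is a simplex $S\subset K$ with barycenter at the origin such that $$\left(\frac{\mathrm{vol}(S)}{\mathrm{vol}(K)}\right)^{1/n}\ge \frac{c\,L_K}{\sqrt{n}}.$$
   Context: A convex body in $\mathbb{R}^n$ is a compact convex set with non-empty interior. $\mathrm{vol}$ denotes Lebesgue measure in $\mathbb{R}^n$. A simplex in $\mathbb{R}^n$ always means an $n$-simplex, i.e. the convex hull of $n+1$ affinely independent points of $\mathbb{R}^n$. The barycenter of a convex body $K$ is $\frac{1}{\mathrm{vol}(K)}\int_K x\,dx$. A convex body $K\subset\mathbb{R}^n$ is isotropic if $\mathrm{vol}(K)=1$, $\int_K x\,dx=0$, and there is a constant $L_K>0$ such that $\int_K\langle x,\theta\rangle^2\,dx=L_K^2$ for all $\theta$ in the Euclidean unit sphere $S^{n-1}$. For every convex body $K$ with barycenter at the origin there is $A\in GL(n)$ such that $A(K)$ is isotropic, and this isotropic image is unique up to orthogonal transformations; the isotropic constant of $K$ is $L_K:=L_{A(K)}$, which is therefore well defined and invariant under invertible linear maps. *)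

(* Defs.v *)
From HB Require Import structures.
From mathcomp Require Import all_boot all_order all_algebra.
From mathcomp Require Import all_classical all_reals all_analysis.

Set Implicit Arguments.
Unset Strict Implicit.
Unset Printing Implicit Defensive.

Import Order.TTheory GRing.Theory Num.Theory.
Import numFieldNormedType.Exports.

Local Open Scope classical_set_scope.
Local Open Scope ring_scope.

Section measurable_rV.
Context {R : realType} {n : nat}.

Let coors : 'I_n -> 'rV[R]_n -> measurableTypeR R := fun i x => x ord0 i.

Let rV_set0 : g_sigma_preimage coors set0.
Proof. exact: sigma_algebra0. Qed.

Let rV_setC A : g_sigma_preimage coors A -> g_sigma_preimage coors (~` A).
Proof. exact: sigma_algebraC. Qed.

Let rV_bigcup (F : (set 'rV[R]_n)^nat) :
  (forall i, g_sigma_preimage coors (F i)) ->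
  g_sigma_preimage coors (\bigcup_i (F i)).
Proof. exact: sigma_algebra_bigcup. Qed.

(* The sigma-algebra generated by the coordinates, i.e., the Borel sets of the
   usual topology. *)
HB.instance Definition _ := @isMeasurable.Build default_measure_display
  'rV[R]_n (g_sigma_preimage coors) rV_set0 rV_setC rV_bigcup.

Lemma measurable_coord_rV (i : 'I_n) :
  measurable_fun [set: 'rV[R]_n] (fun x => x ord0 i : measurableTypeR R).
Proof.
move=> _ Y mY; rewrite setTI; apply: sub_sigma_algebra => /=.
rewrite -bigcup_seq/=; exists i => /=; first by rewrite mem_index_enum.
by exists Y => //; rewrite setTI.
Qed.

Lemma measurable_fun_rV d (T : measurableType d) (f : T -> 'rV[R]_n) :
  (forall i, measurable_fun [set: T] (fun x => f x ord0 i : measurableTypeR R)) ->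
  measurable_fun [set: T] f.
Proof.
move=> mf _ A mA; rewrite setTI; move: A mA.
suff : @measurable _ 'rV[R]_n `<=` image_set_system setT f measurable.
  by move=> h A /h; rewrite /image_set_system/= setTI.
apply: smallest_sub; first exact/sigma_algebra_image/sigma_algebra_measurable.
rewrite -bigcup_seq => A [i _] [B mB <-].
by rewrite /image_set_system/= setTI; exact: mf.
Qed.

End measurable_rV.

Section lebesgue_rV.
Context {R : realType}.

Definition cons_rV n (u : measurableTypeR R * 'rV[R]_n) : 'rV[R]_n.+1 :=
  row_mx (const_mx u.1 : 'rV[R]_1) u.2.

Definition uncons_rV n (x : 'rV[R]_n.+1) : measurableTypeR R * 'rV[R]_n :=
  (x ord0 ord0, rsubmx (x : 'rV[R]_(1 + n))).

Lemma cons_rVK n : cancel (@cons_rV n) (@uncons_rV n).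
Proof.
move=> [a x]; rewrite /uncons_rV /cons_rV row_mxKr/=; congr pair.
by rewrite mxE; case: splitP => [j _|j //]; rewrite mxE.
Qed.

Lemma measurable_cons_rV n : measurable_fun [set: _] (@cons_rV n).
Proof.
apply: measurable_fun_rV => i.
have [j ij|j ij] := @splitP 1 n i.
  rewrite (_ : (fun _ => _) = fst)//; apply/funext => u.
  by rewrite mxE; case: splitP => [k _|k]; rewrite ?mxE// ij (ord1 j).
rewrite (_ : (fun _ => _) = (fun v : 'rV[R]_n => v ord0 j) \o snd).
  by apply: measurableT_comp => //; exact: measurable_coord_rV.
apply/funext => u; rewrite mxE; case: splitP => [k|k]; rewrite ij.
  by rewrite (ord1 k).
by move=> /addnI/ord_inj ->.
Qed.

Lemma measurable_uncons_rV n : measurable_fun [set: _] (@uncons_rV n).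
Proof.
apply/measurable_fun_pairP; split; first exact: measurable_coord_rV.
apply: measurable_fun_rV => i.
rewrite (_ : (fun _ => _) = fun x : 'rV[R]_n.+1 => x ord0 (rshift 1 i)).
  exact: measurable_coord_rV.
by apply/funext => x; rewrite /= mxE.
Qed.

Section step.
Local Open Scope ereal_scope.
Context n (mu : {sigma_finite_measure set 'rV[R]_n -> \bar R}).

(* The product of the Lebesgue measures of R and R^n, transported to R^(n+1). *)
Definition lebesgue_cons : set 'rV[R]_n.+1 -> \bar R :=
  pushforward (lebesgue_measure \x mu) (@cons_rV n).

Let lebesgue_cons0 : lebesgue_cons set0 = 0.
Proof. by rewrite /lebesgue_cons /pushforward preimage_set0 measure0. Qed.

Let lebesgue_cons_ge0 A : 0 <= lebesgue_cons A.
Proof. by rewrite /lebesgue_cons /pushforward measure_ge0. Qed.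

Let lebesgue_cons_sigma_additive : semi_sigma_additive lebesgue_cons.
Proof.
have mpre A : measurable A -> measurable (@cons_rV n @^-1` A).
  by move=> mA; rewrite -[X in measurable X]setTI; exact: measurable_cons_rV.
move=> F mF tF mUF; rewrite /lebesgue_cons /pushforward preimage_bigcup.
apply: measure_semi_sigma_additive.
- by move=> k; exact: mpre.
- apply/trivIsetP => /= i j _ _ ij; rewrite -preimage_setI.
  by move/trivIsetP : tF => /(_ _ _ _ _ ij) ->//; rewrite preimage_set0.
- by rewrite -preimage_bigcup; exact: mpre.
Qed.

HB.instance Definition _ := isMeasure.Build _ _ _ lebesgue_cons
  lebesgue_cons0 lebesgue_cons_ge0 lebesgue_cons_sigma_additive.

Let lebesgue_cons_sigma_finite : sigma_finite setT lebesgue_cons.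
Proof.
have /sigma_finiteP[F [TF ndF Foo]] := sigma_finiteT (@lebesgue_measure R).
have /sigma_finiteP[G [TG ndG Goo]] := sigma_finiteT mu.
exists (fun k => @uncons_rV n @^-1` (F k `*` G k)).
  apply/esym; rewrite -subTset => x _.
  have [k _ Fk] : (\bigcup_k F k) (uncons_rV x).1 by rewrite -TF.
  have [l _ Gl] : (\bigcup_k G k) (uncons_rV x).2 by rewrite -TG.
  exists (maxn k l) => //; split.
  - by apply: subsetPset Fk; exact/ndF/leq_maxl.
  - by apply: subsetPset Gl; exact/ndG/leq_maxr.
move=> k; have [mF Fk] := Foo k; have [mG Gk] := Goo k; split.
  rewrite -[X in measurable X]setTI; apply: measurable_uncons_rV => //.
  exact: measurableX.
rewrite /lebesgue_cons /pushforward -comp_preimage.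
rewrite (_ : _ \o _ = id); last by apply/funext; exact: cons_rVK.
by rewrite preimage_id product_measure1E// lte_mul_pinfty// ge0_fin_numE.
Qed.

HB.instance Definition _ := Measure_isSigmaFinite.Build _ _ _ lebesgue_cons
  lebesgue_cons_sigma_finite.

End step.

(* R^0 is a point, of measure 1. *)
Fixpoint lebesgue_rV n : {sigma_finite_measure set 'rV[R]_n -> \bar R} :=
  if n is n'.+1 then lebesgue_cons (lebesgue_rV n') else \d_(0 : 'rV[R]_0).

End lebesgue_rV.

Section lebesgue_rV_product.
Context {R : realType}.

(* Characterizes lebesgue_rV n as the Lebesgue measure on the Borel sets. *)
Lemma lebesgue_rV_prod n (A : 'I_n -> set (measurableTypeR R)) :
  (forall i, measurable (A i)) ->
  lebesgue_rV n [set x : 'rV[R]_n | forall i, A i (x ord0 i)] =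
  (\prod_(i < n) lebesgue_measure (A i))%E.
Proof.
elim: n A => [|n IHn] A mA.
  by rewrite big_ord0 /= diracE mem_set// => -[].
rewrite big_ord_recl -IHn// -product_measure1E//; last first.
  rewrite [X in measurable X](_ : _ =
    \bigcap_(i in [set: 'I_n]) (fun x : 'rV[R]_n => x ord0 i) @^-1` A (lift ord0 i)).
    apply: fin_bigcap_measurable => // i _.
    by rewrite -[X in measurable X]setTI; exact: measurable_coord_rV.
  by apply/seteqP; split => [x xA i _|x xA i]; exact: xA.
rewrite /= /lebesgue_cons /pushforward; congr product_measure1.
have cons0 u : @cons_rV R n u ord0 ord0 = u.1.
  by rewrite -[in RHS](cons_rVK u).
have consS u i : @cons_rV R n u ord0 (lift ord0 i) = u.2 ord0 i.
  rewrite -[in RHS](cons_rVK u) [RHS]mxE; suff -> : lift ord0 i = rshift 1 i by []; exact: ord_inj.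
apply/seteqP; split=> [u /= uA|u /= [uA0 uA] i].
  by split=> [|i]; [rewrite -cons0|rewrite -consS].
by have [j ->|->] := unliftP ord0 i; rewrite ?consS ?cons0.
Qed.

End lebesgue_rV_product.

Section convex_bodies.
Context {R : realType} {n : nat}.
Implicit Types (K S A : set 'rV[R]_n) (x y : 'rV[R]_n).

Definition vol K : R := fine (lebesgue_rV n K).

Definition convex_body K := [/\ compact K, convex_set K & K° !=set0].

Definition dot x y : R := \sum_(i < n) x ord0 i * y ord0 i.

Definition vintegral K : 'rV[R]_n :=
  \row_(i < n) \int[lebesgue_rV n]_(x in K) (x ord0 i).

Definition barycenter K : 'rV[R]_n := (vol K)^-1 *: vintegral K.

Definition isotropic_with K (L : R) :=
  [/\ convex_body K, vol K = 1, vintegral K = 0, 0 < L &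
      forall theta, dot theta theta = 1 ->
        \int[lebesgue_rV n]_(x in K) (dot x theta) ^+ 2 = L ^+ 2].

(* The maps x |-> x *m T on row vectors, T invertible, are all of GL(n). The value 0 is only
   a default: a convex body with barycenter at the origin has an isotropic
   image, and L does not depend on the choice of T. *)
Definition isotropic_constant K : R :=
  xget 0 [set L : R | exists2 T : 'M[R]_n, T \in unitmx &
                        isotropic_with [set x *m T | x in K] L].

Definition conv_hull A : set 'rV[R]_n := smallest (@convex_set R 'rV[R]_n) A.

Definition affinely_independent m (v : 'I_m -> 'rV[R]_n) :=
  forall a : 'I_m -> R,
    \sum_i a i = 0 -> \sum_i a i *: v i = 0 -> forall i, a i = 0.

Definition simplex S := exists2 v : 'I_n.+1 -> 'rV[R]_n,
  affinely_independent v & S = conv_hull (range v).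

End convex_bodies.

(* Main.v *)
(* Apply a linear map bringing K to isotropic position, and write L
for its isotropic constant. The points x_1, ..., x_n of K are chosen one after the other.
The sum over all completions of x_1, ..., x_k by vectors of the standard basis
of the squared determinant, viewed as a function of x_k alone, is a sum of squares of linear
forms; so its mean over K is L^2 times the sum of the squared norms of these forms, which is the
same sum for x_1, ..., x_(k-1). By the fourth moment inequality
int l^4 <= 144 (int l^2)^2 for centered linear forms l, a point x_k can be
chosen where it is at least L^2/4 times that sum and where, at the same time,
|x_k| and the component of x_k along x_1 + ... + x_(k-1) stay bounded by
multiples of sqrt n L and L. This gives det(x_1, ..., x_n)^2 >= (L^2/4)^n n! and
|x_1 + ... + x_n| <= C n L. Since K contains a ball of radius L/68 (fourth
moments again), a small negative multiple of the barycenter of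
conv(0, x_1, ..., x_n) lies in K, and contracting this simplex towards that point
centers it at the cost of a factor c^n in the volume.

The fourth moment inequality is the Prekopa-Leindler inequality applied to
l^4 on {|l| >= 6 s}, to the indicator of {|l| <= 2 s} and to 9 l^2, where
s^2 = int l^2. *)
From HB Require Import structures.
Require Import Defs.
From mathcomp Require Import all_boot all_order all_algebra.
From mathcomp Require Import all_classical all_reals all_analysis.
From mathcomp Require Import measurable_realfun perm ring lra.

Set Implicit Arguments.
Unset Strict Implicit.
Unset Printing Implicit Defensive.

Import Order.TTheory GRing.Theory Num.Theory.
Import numFieldNormedType.Exports.

Local Open Scope classical_set_scope.
Local Open Scope ring_scope.

(** * Iterated integrals and linear changes of variables *)

Section iterated_integral.
Context {R : realType}.
Local Notation mu := (@lebesgue_measure R).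

Lemma ge0_integral_rVS n (f : 'rV[R]_n.+1 -> \bar R) :
  measurable_fun [set: 'rV[R]_n.+1] f -> (forall x, 0 <= f x)%E ->
  (\int[lebesgue_rV n.+1]_x f x =
   \int[mu]_t \int[lebesgue_rV n]_x f (cons_rV (t, x)))%E.
Proof.
move=> mf f0.
rewrite [LHS]ge0_integral_pushforward//; last exact: measurable_cons_rV.
rewrite preimage_setT fubini_tonelli1//; last by move=> u; exact: f0.
by apply: measurableT_comp => //; exact: measurable_cons_rV.
Qed.

Lemma ge0_integral_rVS_swap n (f : 'rV[R]_n.+1 -> \bar R) :
  measurable_fun [set: 'rV[R]_n.+1] f -> (forall x, 0 <= f x)%E ->
  (\int[lebesgue_rV n.+1]_x f x =
   \int[lebesgue_rV n]_x \int[mu]_t f (cons_rV (t, x)))%E.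
Proof.
move=> mf f0.
rewrite [LHS]ge0_integral_pushforward//; last exact: measurable_cons_rV.
rewrite preimage_setT fubini_tonelli2//; last by move=> u; exact: f0.
by apply: measurableT_comp => //; exact: measurable_cons_rV.
Qed.

Lemma measurable_consr n (f : 'rV[R]_n.+1 -> \bar R) t :
  measurable_fun [set: 'rV[R]_n.+1] f -> measurable_fun setT (fun x => f (cons_rV (t, x))).
Proof.
move=> mf; apply: measurableT_comp => //.
by apply: measurableT_comp; [exact: measurable_cons_rV|exact: pair1_measurable].
Qed.

Lemma measurable_integral_consr n (f : 'rV[R]_n.+1 -> \bar R) :
  measurable_fun [set: 'rV[R]_n.+1] f -> (forall x, 0 <= f x)%E ->
  measurable_fun setT (fun t => \int[lebesgue_rV n]_x f (cons_rV (t, x)))%E.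
Proof.
move=> mf f0; apply: (measurable_fun_fubini_tonelli_F (fun u => f (cons_rV u))).
  by apply: measurableT_comp => //; exact: measurable_cons_rV.
by move=> u; exact: f0.
Qed.

Lemma ge0_integral_lebesgueD (c : R) (f : R -> \bar R) :
  measurable_fun setT f -> (forall x, 0 <= f x)%E ->
  (\int[mu]_t f (t + c)%R = \int[mu]_t f t)%E.
Proof.
move=> mf f0; pose s := (fun t => t + c) : measurableTypeR R -> measurableTypeR R.
have ms : measurable_fun setT s by apply: measurable_funD.
pose S : {mfun _ >-> _} := HB.pack s (isMeasurableFun.Build _ _ _ _ _ ms).
transitivity (\int[pushforward mu S]_t f t)%E.
  by rewrite ge0_integral_pushforward// preimage_setT.
apply: eq_measure_integral => //= A mA _.
apply/esym/lebesgue_measure_unique => //= _ [[a b]] _ <-.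
rewrite /pushforward /=.
rewrite [X in _ = mu X](_ : _ = `]a - c, b - c]%classic); last first.
  by apply/seteqP; split => x /=; rewrite !in_itv/= ltrBlDr lerBrDr.
rewrite !lebesgue_measure_itv/= !lte_fin ltrD2r.
by case: ifP => // _; congr (_%:E); ring.
Qed.

Lemma ge0_integral_lebesgueM (a : R) (f : R -> \bar R) : a != 0 ->
  measurable_fun setT f -> (forall x, 0 <= f x)%E ->
  (\int[mu]_t f (a * t)%R = (`|a|^-1)%:E * \int[mu]_t f t)%E.
Proof.
wlog : a f / 0 < a.
  move=> H a0 mf f0; have : 0 < a \/ 0 < - a.
    by rewrite oppr_gt0; move: a0; rewrite neq_lt => /orP[]; [right|left].
  case=> a_0; first exact: H.
  have mN : measurable_fun setT (-%R : measurableTypeR R -> measurableTypeR R).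
    exact: oppr_measurable.
  transitivity (\int[mu]_t f ((- a) * - t)%R)%E.
    by apply: eq_integral => t _; rewrite mulrNN.
  transitivity (\int[pushforward mu (-%R : _ -> measurableTypeR R)]_t f ((- a) * t)%R)%E.
    rewrite ge0_integral_pushforward//.
    by apply: measurableT_comp => //; apply: measurable_funM.
  transitivity (\int[mu]_t f ((- a) * t)%R)%E.
    by apply: eq_measure_integral => //= A mA _; exact: lebesgue_measureN.
  by rewrite H ?oppr_eq0// normrN.
move=> a0 _ mf f0; rewrite gtr0_norm//.
pose s := (fun t => a * t) : measurableTypeR R -> measurableTypeR R.
have ms : measurable_fun setT s by apply: measurable_funM.
pose S : {mfun _ >-> _} := HB.pack s (isMeasurableFun.Build _ _ _ _ _ ms).
have a1 : 0 <= a by exact: ltW.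
have {1}-> : (a^-1 = (NngNum a1)%:num^-1)%R by [].
transitivity (\int[pushforward mu S]_t f t)%E.
  by rewrite ge0_integral_pushforward// preimage_setT.
pose nu : {measure set measurableTypeR R -> \bar R} := pushforward mu S.
pose nu' : {measure set measurableTypeR R -> \bar R} := mscale (NngNum a1) (nu ms).
have -> : (\int[mu]_t f t = \int[nu']_t f t)%E.
  apply: eq_measure_integral => A mA _.
  apply: (lebesgue_measure_unique (mu := nu')) => //= _ [[x y]] _ <-.
  rewrite /nu' /nu /mscale /pushforward /=.
  rewrite [X in _ = (_ * mu X)%E](_ : _ = `]x / a, y / a]%classic); last first.
    apply/seteqP; split => z /=; rewrite !in_itv/= ltr_pdivrMr// ler_pdivlMr//;
    by rewrite !(mulrC z).
  rewrite !lebesgue_measure_itv/= !lte_fin ltr_pM2r ?invr_gt0//.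
  case: ifP => _; last by rewrite mule0.
  by rewrite -EFinB -EFinM; congr (_%:E); field; rewrite gt_eqF.
by rewrite /nu' ge0_integral_mscale//= muleA -EFinM mulVf ?gt_eqF// mul1e.
Qed.

End iterated_integral.

Section linear_change_of_variables.
Context {R : realType}.
Local Notation mu := (@lebesgue_measure R).

Lemma measurable_mulmxr m n (A : 'M[R]_(m, n)) :
  measurable_fun [set: 'rV[R]_m] (fun x => x *m A).
Proof.
apply: measurable_fun_rV => i.
under eq_fun do rewrite mxE.
apply: measurable_sum => k; apply: measurable_funM => //.
exact: measurable_coord_rV.
Qed.

Lemma measurable_addrV n (v : 'rV[R]_n) :
  measurable_fun [set: 'rV[R]_n] (fun x => x + v).
Proof.
apply: measurable_fun_rV => i; under eq_fun do rewrite mxE.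
by apply: measurable_funD => //; exact: measurable_coord_rV.
Qed.

Lemma cons_rVE n t (x : 'rV[R]_n) :
  cons_rV (t, x) = row_mx t%:M x :> 'rV[R]_(1 + n).
Proof.
rewrite /cons_rV; congr row_mx; apply/matrixP => i j.
by rewrite !mxE !ord1 eqxx mulr1n.
Qed.

Lemma uncons_rVK n : cancel (@uncons_rV R n) (@cons_rV R n).
Proof.
move=> x; rewrite /uncons_rV cons_rVE.
have -> : (x ord0 ord0)%:M = lsubmx (x : 'rV_(1 + n)).
  apply/matrixP => i j; rewrite !mxE !ord1 eqxx mulr1n.
  by congr (x _ _); exact: ord_inj.
exact: (@hsubmxK _ 1 1 n).
Qed.

Lemma cons_rVD n (s t : R) (x y : 'rV[R]_n) :
  cons_rV (s, x) + cons_rV (t, y) = cons_rV (s + t, x + y).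
Proof.
rewrite !cons_rVE (_ : (s + t)%:M = s%:M + t%:M) ?raddfD//.
by rewrite -add_row_mx.
Qed.

Lemma cons_rVZ n (a t : R) (x : 'rV[R]_n) :
  a *: cons_rV (t, x) = cons_rV (a * t, a *: x).
Proof.
by rewrite !cons_rVE -scale_scalar_mx -scale_row_mx.
Qed.

Lemma ge0_integral_rVD n (v : 'rV[R]_n) (f : 'rV[R]_n -> \bar R) :
  measurable_fun [set: 'rV[R]_n] f -> (forall x, 0 <= f x)%E ->
  (\int[lebesgue_rV n]_x f (x + v)%R = \int[lebesgue_rV n]_x f x)%E.
Proof.
elim: n v f => [|n IHn] v f mf f0.
  by apply: eq_integral => x _; congr f; apply/rowP => -[].
rewrite !ge0_integral_rVS//; last first.
  by apply: measurableT_comp => //; exact: measurable_addrV.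
pose F t := (\int[lebesgue_rV n]_x f (cons_rV (t, x)))%E.
have mF : measurable_fun setT F by exact: measurable_integral_consr.
rewrite -(ge0_integral_lebesgueD (v ord0 ord0) mF); last first.
  by move=> t; apply: integral_ge0.
apply: eq_integral => t _; rewrite /F.
rewrite -[RHS](IHn (rsubmx (v : 'rV_(1 + n))))//; last exact: measurable_consr.
apply: eq_integral => x _; congr f.
by rewrite -[X in _ + X](@uncons_rVK n) cons_rVD.
Qed.

Definition det_scaled n (A : 'M[R]_n) :=
  forall f : 'rV[R]_n -> \bar R,
  measurable_fun [set: 'rV[R]_n] f -> (forall x, 0 <= f x)%E ->
  (\int[lebesgue_rV n]_x f (x *m A) =
   (`|\det A|^-1)%:E * \int[lebesgue_rV n]_x f x)%E.

Lemma det_scaledM n (A B : 'M[R]_n) :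
  det_scaled A -> det_scaled B -> det_scaled (A *m B).
Proof.
move=> HA HB f mf f0; under eq_integral do rewrite mulmxA.
rewrite (HA (fun x => f (x *m B)))//; last first.
  by apply: measurableT_comp => //; exact: measurable_mulmxr.
by rewrite HB// muleA -EFinM det_mulmx normrM invfM.
Qed.

Lemma det_scaled_ushear n (w : 'rV[R]_n) :
  det_scaled (block_mx 1%:M w 0 1%:M : 'M[R]_(1 + n)).
Proof.
move=> f mf f0; rewrite !ge0_integral_rVS//; last first.
  by apply: measurableT_comp => //; exact: measurable_mulmxr.
rewrite det_ublock !det1 mulr1 normr1 invr1 mul1e.
apply: eq_integral => t _.
rewrite -[RHS](ge0_integral_rVD (t *: w))//; last exact: measurable_consr.
apply: eq_integral => x _; congr f; rewrite !cons_rVE mul_row_block.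
by rewrite !mulmx1 mulmx0 addr0 mul_scalar_mx addrC.
Qed.

Lemma det_scaled_lshear n (c : 'cV[R]_n) :
  det_scaled (block_mx 1%:M 0 c 1%:M : 'M[R]_(1 + n)).
Proof.
move=> f mf f0; rewrite !ge0_integral_rVS_swap//; last first.
  by apply: measurableT_comp => //; exact: measurable_mulmxr.
rewrite det_lblock !det1 mulr1 normr1 invr1 mul1e.
apply: eq_integral => x _.
rewrite -[RHS](ge0_integral_lebesgueD ((x *m c) ord0 ord0))//; last first.
  apply: measurableT_comp => //.
  by apply: measurableT_comp; [exact: measurable_cons_rV|exact: pair2_measurable].
apply: eq_integral => t _; congr f; rewrite !cons_rVE mul_row_block.
rewrite !mulmx1 mulmx0 add0r; congr row_mx.
by rewrite [X in _ + X]mx11_scalar raddfD.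
Qed.

Lemma det_scaled_diag n (a : R) (D : 'M[R]_n) : a != 0 -> det_scaled D ->
  det_scaled (block_mx a%:M 0 0 D : 'M[R]_(1 + n)).
Proof.
move=> a0 HD f mf f0; rewrite !ge0_integral_rVS//; last first.
  by apply: measurableT_comp => //; exact: measurable_mulmxr.
pose F t := (\int[lebesgue_rV n]_x f (cons_rV (t, x)))%E.
have mF : measurable_fun setT F by exact: measurable_integral_consr.
have F0 t : (0 <= F t)%E by apply: integral_ge0.
transitivity (\int[mu]_t ((`|\det D|^-1)%:E * F (a * t)%R))%E.
  apply: eq_integral => t _; rewrite /F.
  rewrite -(HD (fun x => f (cons_rV (a * t, x))))//; last exact: measurable_consr.
  apply: eq_integral => x _; congr f; rewrite !cons_rVE mul_row_block.
  by rewrite !mulmx0 addr0 add0r -scalar_mxM mulrC.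
have mFa : measurable_fun setT (fun t => F (a * t)).
  by apply: (measurableT_comp mF); apply: measurable_funM.
have d0 : (0 <= (`|\det D|^-1)%:E)%E by rewrite lee_fin invr_ge0.
rewrite (ge0_integralZl mu measurableT mFa (fun t _ => F0 (a * t)) d0).
rewrite ge0_integral_lebesgueM// muleA -EFinM -invfM -normrM mulrC.
by rewrite det_ublock det_scalar1.
Qed.

Lemma det_scaled_unitmx n (A : 'M[R]_n) : A \in unitmx -> det_scaled A.
Proof.
elim: n A => [|n IHn] A uA.
  move=> f mf f0; rewrite det_mx00 normr1 invr1 mul1e.
  by apply: eq_integral => x _; congr f; apply/rowP => -[].
have pivot (B : 'M[R]_(1 + n)) : B \in unitmx -> B ord0 ord0 != 0 -> det_scaled B.
  move=> uB; rewrite -[B]submxK.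
  set ul := ulsubmx B; set ur := ursubmx B; set dl := dlsubmx B.
  set dr := drsubmx B.
  have -> : (block_mx ul ur dl dr) ord0 ord0 = ul ord0 ord0.
    rewrite /block_mx mxE; case: splitP => // i _; rewrite ord1 mxE.
    by case: splitP => // j _; rewrite ord1.
  move=> a0; set a := ul ord0 ord0 in a0.
  pose D' := dr - a^-1 *: (dl *m ur).
  have E : block_mx ul ur dl dr = block_mx 1%:M 0 (a^-1 *: dl) 1%:M *m
     block_mx a%:M 0 0 D' *m block_mx 1%:M (a^-1 *: ur) 0 1%:M.
    rewrite !mulmx_block !(mul1mx, mulmx1, mulmx0, mul0mx, addr0, add0r).
    rewrite [in LHS](mx11_scalar ul) -/a.
    rewrite !mul_scalar_mx !mul_mx_scalar !scalerA mulfV// !scale1r.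
    by rewrite -scalemxAr /D' addrC addrNK.
  have uD' : D' \in unitmx.
    move: uB; rewrite -[B]submxK -/ul -/ur -/dl -/dr E !unitmx_mul.
    case/andP => /andP[_ +] _; rewrite !unitmxE det_ublock unitrM.
    by case/andP.
  rewrite E; apply: det_scaledM; last exact: det_scaled_ushear.
  apply: det_scaledM; first exact: det_scaled_lshear.
  by apply: det_scaled_diag => //; exact: IHn.
have [A00|] := eqVneq (A ord0 ord0) 0; last exact: pivot.
have [i Ai] : exists i, A i ord0 != 0.
  apply: contrapT => /forallNP H; move: uA; rewrite unitmxE.
  rewrite (expand_det_col _ ord0) big1 ?unitr0// => i _.
  by have /negP/negPn/eqP -> := H i; rewrite mul0r.
have [j ij] : exists j : 'I_n, i = rshift 1 j :> 'I_(1 + n).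
  have [j ij|j ij] := @splitP 1 n i; last by exists j; exact: ord_inj.
  by move: Ai; rewrite (_ : i = ord0) ?A00 ?eqxx//; apply: ord_inj; rewrite ij ord1.
pose u : 'rV[R]_n := delta_mx ord0 j.
have S_unit w : (block_mx 1%:M w 0 1%:M : 'M[R]_(1 + n)) \in unitmx.
  by rewrite unitmxE det_ublock !det1 mulr1 unitr1.
have -> : A = block_mx 1%:M (- u) 0 1%:M *m (block_mx 1%:M u 0 1%:M *m (A : 'M[R]_(1 + n))).
  rewrite mulmxA mulmx_block !(mul1mx, mulmx1, mulmx0, mul0mx, addr0, add0r).
  by rewrite subrr -scalar_mx_block mul1mx.
apply: det_scaledM; first exact: det_scaled_ushear.
apply: pivot; first by rewrite unitmx_mul S_unit.
rewrite -[A in X in X != _](submxK (A : 'M[R]_(1 + n))) mulmx_block.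
rewrite /block_mx mxE; case: splitP => // k _; rewrite ord1 mxE.
case: splitP => // l _; rewrite ord1 mul1mx mxE.
rewrite -rowE !mxE.
rewrite [X in A X](_ : _ = ord0) 1?[X in A _ X](_ : _ = ord0); try exact: ord_inj.
by rewrite A00 add0r -ij [X in A _ X](_ : _ = ord0)//; exact: ord_inj.
Qed.

Lemma ge0_integral_mulmx n (A : 'M[R]_n) (f : 'rV[R]_n -> \bar R) :
  A \in unitmx ->
  measurable_fun [set: 'rV[R]_n] f -> (forall x, 0 <= f x)%E ->
  (\int[lebesgue_rV n]_x f (x *m A) =
   (`|\det A|^-1)%:E * \int[lebesgue_rV n]_x f x)%E.
Proof. by move=> /det_scaled_unitmx; exact. Qed.

End linear_change_of_variables.

(** * The Prekopa-Leindler inequality *)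

Section superlevel_sets.
Context {R : realType}.
Local Notation mu := (@lebesgue_measure R).

Lemma layer_cake (f : R -> \bar R) :
  measurable_fun setT f -> (forall x, 0 <= f x)%E ->
  (\int[mu]_x f x = \int[mu]_(s in `]0%R, +oo[) mu [set x | s%:E < f x])%E.
Proof.
move=> mf f0.
pose D : set (measurableTypeR R * measurableTypeR R) :=
  [set p | 0 < p.2 /\ (p.2%:E < f p.1)%E].
have mD : measurable D.
  rewrite [D](_ : _ = [set p | 0 < p.2] `&` [set p | (p.2%:E < f p.1)%E])//.
  apply: measurableI.
    have : measurable_fun setT (fun p : measurableTypeR R * measurableTypeR R => 0 < p.2).
      exact: measurable_fun_ltr.
    by move=> /(_ measurableT [set true]); rewrite setTI; exact.
  rewrite -[X in measurable X]setTI; apply: measurable_lte => //.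
    by apply: measurableT_comp.
  by apply: (measurableT_comp mf).
pose phi p := (\1_D p : R)%:E.
have mphi : measurable_fun setT phi.
  by apply: measurableT_comp => //; exact: measurable_indic.
transitivity (\int[mu]_x \int[mu]_s phi (x, s))%E.
  apply: eq_integral => x _.
  rewrite /phi [RHS](_ : _ = mu [set s | D (x, s)]).
    rewrite /D/=; have := f0 x; case: (f x) => [r r0| |//].
    - rewrite [X in mu X](_ : _ = `]0, r[%classic); last first.
        by apply/seteqP; split => s /=; rewrite in_itv/= lte_fin => /andP.
      rewrite lebesgue_measure_itv/= lte_fin oppr0 adde0.
      by case: ltP => // r0'; apply/eqP; rewrite eqe eq_le r0' -lee_fin r0.
    - move=> _; rewrite [X in mu X](_ : _ = `]0, +oo[%classic); last first.
        by apply/seteqP; split => s /=; rewrite in_itv/= andbT ltry => // -[].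
      by rewrite lebesgue_measure_itv/= ltry.
  rewrite -(setIT [set s | D (x, s)]).
  rewrite -[RHS]integral_indic//.
  rewrite -[X in measurable X]setTI.
  by apply: (pair1_measurable x).
rewrite (fubini_tonelli phi mphi); last by move=> p; rewrite lee_fin.
rewrite [RHS]integral_mkcond; apply: eq_integral => s _.
rewrite patchE; have [s0|s0] := ltP 0 s; last first.
  rewrite memNset; last by rewrite /= in_itv/= andbT; apply/negP; rewrite -leNgt.
  rewrite integral0_eq// => x _; rewrite /phi indicE memNset//.
  by rewrite /D/= => -[]; rewrite ltNge s0.
rewrite mem_set; last by rewrite /= in_itv/= andbT.
rewrite -[X in mu X]setIT -integral_indic//.
  apply: eq_integral => x _; congr (_%:E); rewrite /phi !indicE; congr (_%:R).
  by congr nat_of_bool; apply/idP/idP; rewrite !inE => //= -[].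
rewrite -[X in measurable X]setTI.
by apply: measurable_lte.
Qed.

Lemma lebesgue_measure_affine (a c : R) (A : set R) : a != 0 -> measurable A ->
  mu [set t | A (a * t + c)] = ((`|a|^-1)%:E * mu A)%E.
Proof.
move=> a0 mA.
have mf : measurable_fun [set: R] (fun t => (\1_A t : R)%:E).
  by apply: measurableT_comp => //; exact: measurable_indic.
pose f := fun t : R => (\1_A t : R)%:E.
have mfc : measurable_fun [set: R] (fun t => f (t + c)).
  by apply: (measurableT_comp mf); exact: measurable_funD.
transitivity (\int[mu]_t f (a * t + c)%R)%E.
  rewrite -[X in mu X]setIT -integral_indic//.
  rewrite -[X in measurable X]setTI.
  by apply: (measurable_funD (measurable_funM _ _)).
rewrite (ge0_integral_lebesgueM (f := fun t => f (t + c)))//; last first.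
  by move=> t; rewrite lee_fin.
rewrite ge0_integral_lebesgueD//; last by move=> t; rewrite lee_fin.
by rewrite integral_indic// setIT.
Qed.

End superlevel_sets.

Section midpoint_measure.
Context {R : realType}.
Local Notation mu := (@lebesgue_measure R).

Lemma lebesgue_measure_midpoint (A B C : set R) :
  measurable A -> measurable B -> measurable C -> has_sup A -> has_inf B ->
  (forall a b, A a -> B b -> C (2^-1 * (a + b))) ->
  (mu A + mu B <= 2%:E * mu C)%E.
Proof.
move=> mA mB mC sA iB ABC; apply/lee_addgt0Pr => e e0.
have e20 : 0 < e / 2 by rewrite divr_gt0.
have [a Aa ae] := sup_adherent e20 sA.
have [b Bb be] := inf_adherent e20 iB.
pose A1 := A `&` `]-oo, a]; pose B1 := B `&` `]b, +oo[.
have mA1 : measurable A1 by exact: measurableI.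
have mB1 : measurable B1 by exact: measurableI.
have AA1 : (mu A <= mu A1 + (e / 2)%:E)%E.
  apply: (@le_trans _ _ (mu (A1 `|` `]sup A - e / 2, sup A]))).
    apply: le_measure; rewrite ?inE//; first exact: measurableU.
    move=> x Ax; have [xa|xa] := leP x a.
      by left; split => //=; rewrite in_itv.
    right; rewrite /= in_itv/= (lt_trans ae xa)/=.
    by apply: ub_le_sup => //; case: sA.
  apply: (@le_trans _ _ (mu A1 + mu `](sup A - e / 2)%R, sup A]))%E.
    exact: measureU2.
  rewrite leeD2l// lebesgue_measure_itv/= lte_fin ltrBlDr ltrDl e20.
  by rewrite -EFinB lee_fin opprB addrC subrK.
have BB1 : (mu B <= mu B1 + (e / 2)%:E)%E.
  apply: (@le_trans _ _ (mu (B1 `|` `[inf B, inf B + e / 2[))).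
    apply: le_measure; rewrite ?inE//; first exact: measurableU.
    move=> x Bx; have [xb|xb] := ltP b x.
      by left; split => //=; rewrite in_itv/= xb.
    right; rewrite /= in_itv/= (le_lt_trans xb be) andbT.
    by apply: ge_inf => //; case: iB.
  apply: (@le_trans _ _ (mu B1 + mu `[inf B, (inf B + e / 2)%R[))%E.
    exact: measureU2.
  rewrite leeD2l// lebesgue_measure_itv/= lte_fin ltrDl e20.
  by rewrite -EFinB lee_fin addrC addKr.
pose A2 := [set t : R | A1 (2 * t + (- b))].
pose B2 := [set t : R | B1 (2 * t + (- a))].
have maff c : measurable_fun [set: R] (fun t : R => 2 * t + c).
  by apply: measurable_funD => //; apply: measurable_funM.
have mA2 : measurable A2.
  by rewrite -[A2]setTI; apply: maff.
have mB2 : measurable B2.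
  by rewrite -[B2]setTI; apply: maff.
have A2C : A2 `|` B2 `<=` C.
  move=> t [[A2t _]|[B2t _]].
    by rewrite (_ : t = 2^-1 * ((2 * t + - b) + b)); [exact: ABC|field].
  by rewrite (_ : t = 2^-1 * (a + (2 * t + - a))); [exact: ABC|field].
have A2B2 : [disjoint A2 & B2].
  apply/disj_set2P; apply/seteqP; split => t //= [[_ /=] + [_ /=]].
  rewrite !in_itv/= andbT => h1 h2; lra.
have muA2 : mu A1 = (2%:E * mu A2)%E.
  rewrite lebesgue_measure_affine// muleA -EFinM normr_nat mulfV ?mul1e//.
have muB2 : mu B1 = (2%:E * mu B2)%E.
  rewrite lebesgue_measure_affine// muleA -EFinM normr_nat mulfV ?mul1e//.
apply: (le_trans (leeD AA1 BB1)).
rewrite muA2 muB2 addeACA -EFinD -splitr leeD2r// -ge0_muleDr//.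
rewrite lee_pmul2l// -measureU//; last by apply/disj_set2P.
by apply: le_measure; rewrite ?inE//; exact: measurableU.
Qed.

End midpoint_measure.

Section prekopa_bounded.
Context {R : realType}.
Local Notation mu := (@lebesgue_measure R).

Lemma measurable_superlevel (f : R -> \bar R) s :
  measurable_fun setT f -> measurable [set x : R | (s%:E < f x)%E].
Proof.
move=> mf; rewrite -[X in measurable X]setTI.
by apply: measurable_lte.
Qed.

Lemma measurable_fun_superlevel (f : R -> \bar R) :
  measurable_fun setT f ->
  measurable_fun setT (fun s : R => mu [set x | (s%:E < f x)%E]).
Proof.
move=> mf.
pose D : set (measurableTypeR R * measurableTypeR R) :=
  [set p | (p.2%:E < f p.1)%E].
have mD : measurable D.
  rewrite -[X in measurable X]setTI; apply: measurable_lte => //.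
    by apply: measurableT_comp.
  by apply: (measurableT_comp mf).
have mphi : measurable_fun setT (fun p => (\1_D p : R)%:E).
  by apply: measurableT_comp => //; exact: measurable_indic.
rewrite (_ : (fun s : R => _) = fubini_G mu (fun p => (\1_D p : R)%:E)).
  by apply: measurable_fun_fubini_tonelli_G => // p; rewrite lee_fin.
apply/funext => s; rewrite /fubini_G -[X in mu X = _]setIT -integral_indic//.
exact: measurable_superlevel.
Qed.

Lemma prekopa_leindler1_bounded (f g : R -> R) (h : R -> \bar R) (M r : R) :
  measurable_fun setT f -> measurable_fun setT g -> measurable_fun setT h ->
  (forall x, 0 <= f x <= M) -> (forall x, f x != 0 -> `|x| <= r) ->
  (forall x, 0 <= g x <= M) -> (forall x, g x != 0 -> `|x| <= r) ->
  (forall x, 0 <= h x)%E ->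
  (forall x y, (f x * g y)%:E <= h (2^-1 * (x + y))%R * h (2^-1 * (x + y))%R)%E ->
  ((\int[mu]_x (f x)%:E) * (\int[mu]_x (g x)%:E) <=
   (\int[mu]_x h x) * (\int[mu]_x h x))%E.
Proof.
move=> mf mg mh fM fr gM gr h0 fgh.
have H0 : (0 <= \int[mu]_x h x)%E by exact: integral_ge0.
have [f00|] := pselect (forall x, f x = 0).
  rewrite [X in (X * _)%E]integral0_eq ?mul0e ?mule_ge0// => x _.
  by rewrite f00.
move=> /existsNP[x0 /eqP fx0].
have [g00|] := pselect (forall x, g x = 0).
  rewrite [X in (_ * X <= _)%E]integral0_eq ?mule0 ?mule_ge0// => x _.
  by rewrite g00.
move=> /existsNP[y0 /eqP gy0].
have sf : has_sup (range f).
  by split; [exists (f x0), x0|exists M => _ [x _ <-]; case/andP: (fM x)].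
have sg : has_sup (range g).
  by split; [exists (g y0), y0|exists M => _ [x _ <-]; case/andP: (gM x)].
pose a := sup (range f); pose b := sup (range g).
have fa x : f x <= a by apply: sup_upper_bound => //; exists x.
have gb x : g x <= b by apply: sup_upper_bound => //; exists x.
have a0 : 0 < a.
  by rewrite (lt_le_trans _ (fa x0))// lt_neqAle eq_sym fx0; case/andP: (fM x0).
have b0 : 0 < b.
  by rewrite (lt_le_trans _ (gb y0))// lt_neqAle eq_sym gy0; case/andP: (gM y0).
pose c := Num.sqrt (a * b).
have ab0 : 0 < a * b by rewrite mulr_gt0.
have c0 : 0 < c by rewrite sqrtr_gt0.
have cc : c * c = a * b by rewrite -expr2 sqr_sqrtr// ltW.
pose f' x := (f x / a)%:E; pose g' x := (g x / b)%:E.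
pose h' x := (h x * (c^-1)%:E)%E.
have mf' : measurable_fun setT f'.
  by apply/measurable_EFinP; exact: measurable_funM.
have mg' : measurable_fun setT g'.
  by apply/measurable_EFinP; exact: measurable_funM.
have mh' : measurable_fun setT h' by exact: emeasurable_funM.
have f'0 x : (0 <= f' x)%E.
  by rewrite lee_fin divr_ge0 ?(ltW a0)//; case/andP: (fM x).
have g'0 x : (0 <= g' x)%E.
  by rewrite lee_fin divr_ge0 ?(ltW b0)//; case/andP: (gM x).
have h'0 x : (0 <= h' x)%E by rewrite mule_ge0// lee_fin invr_ge0 ltW.
have key s : 0 < s -> (mu [set x | s%:E < f' x] + mu [set x | s%:E < g' x] <=
    2%:E * mu [set x | s%:E < h' x])%E.
  move=> s0; have [s1|s1] := leP 1 s.
    rewrite (_ : [set x | (s%:E < f' x)%E] = set0); last first.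
      apply/seteqP; split => // x /=; rewrite lte_fin => sfx.
      have := le_lt_trans s1 sfx.
      by rewrite ltNge ler_pdivrMr// mul1r ?fa ?gb.
    rewrite (_ : [set x | (s%:E < g' x)%E] = set0); last first.
      apply/seteqP; split => // x /=; rewrite lte_fin => sfx.
      have := le_lt_trans s1 sfx.
      by rewrite ltNge ler_pdivrMr// mul1r ?fa ?gb.
    by rewrite !measure0 adde0 mule_ge0.
  apply: lebesgue_measure_midpoint; try exact: measurable_superlevel.
  - split.
      have : 0 < a - s * a by rewrite -[X in X - _]mul1r -mulrBl mulr_gt0// subr_gt0.
      move=> /(sup_adherent)/(_ sf)[_ [x _ <-]]; rewrite -/a opprB addrC subrK => sx.
      by exists x; rewrite /= lte_fin ltr_pdivlMr.
    exists r => x /=; rewrite lte_fin => sx; apply: le_trans (ler_norm _) (fr _ _).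
    by apply: contraTneq sx => ->; rewrite mul0r -leNgt ltW.
  - split.
      have : 0 < b - s * b by rewrite -[X in X - _]mul1r -mulrBl mulr_gt0// subr_gt0.
      move=> /(sup_adherent)/(_ sg)[_ [x _ <-]]; rewrite -/b opprB addrC subrK => sx.
      by exists x; rewrite /= lte_fin ltr_pdivlMr.
    exists (- r) => x /=; rewrite lte_fin => sx.
    suff : `|x| <= r by rewrite ler_norml => /andP[].
    by apply: gr; apply: contraTneq sx => ->; rewrite mul0r -leNgt ltW.
  move=> x y /=; rewrite !lte_fin !ltr_pdivlMr// => sx sy.
  have := fgh x y; rewrite /h'; have := h0 (2^-1 * (x + y)).
  case: (h _) => [u u0|_ _|//].
    rewrite -!EFinM lee_fin lte_fin ltr_pdivlMr// => fg.
    rewrite ltNge; apply/negP => usc.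
    have : (s * a) * (s * b) < f x * g y.
      by apply: ltr_pM => //; rewrite mulr_ge0// ltW.
    rewrite mulrACA -cc mulrACA => /lt_le_trans/(_ fg).
    by rewrite ltNge ler_pM.
  by rewrite gt0_mulye ?ltry// lte_fin invr_gt0.
have key' : (\int[mu]_x f' x + \int[mu]_x g' x <= 2%:E * \int[mu]_x h' x)%E.
  rewrite !layer_cake// -ge0_integralZl//; last first.
    by apply: measurable_funTS; exact: measurable_fun_superlevel.
  rewrite -ge0_integralD//; last 2 first.
    by apply: measurable_funTS; exact: measurable_fun_superlevel.
    by apply: measurable_funTS; exact: measurable_fun_superlevel.
  apply: ge0_le_integral => //.
  - by move=> x _; rewrite adde_ge0.
  - apply: emeasurable_funD; apply: measurable_funTS; exact: measurable_fun_superlevel.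
  - apply: emeasurable_funM => //; apply: measurable_funTS; exact: measurable_fun_superlevel.
  - by move=> s; rewrite /= in_itv/= andbT => s0; exact: key.
have Ef : (\int[mu]_x (f x)%:E = a%:E * \int[mu]_x f' x)%E.
  rewrite -ge0_integralZl//; last by rewrite lee_fin ltW.
  by apply: eq_integral => x _; rewrite -EFinM mulrC divfK ?gt_eqF.
have Eg : (\int[mu]_x (g x)%:E = b%:E * \int[mu]_x g' x)%E.
  rewrite -ge0_integralZl//; last by rewrite lee_fin ltW.
  by apply: eq_integral => x _; rewrite -EFinM mulrC divfK ?gt_eqF.
have Eh : (\int[mu]_x h x = c%:E * \int[mu]_x h' x)%E.
  rewrite -ge0_integralZl//; last by rewrite lee_fin ltW.
  by apply: eq_integral => x _; rewrite /h' muleC -muleA -EFinM mulVf ?gt_eqF ?mule1.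
rewrite Ef Eg Eh.
have F0 : (0 <= \int[mu]_x f' x)%E by exact: integral_ge0.
have G0 : (0 <= \int[mu]_x g' x)%E by exact: integral_ge0.
have : (0 <= \int[mu]_x h' x)%E by exact: integral_ge0.
move: F0 G0 key'.
move: (\int[mu]_x f' x)%E (\int[mu]_x g' x)%E (\int[mu]_x h' x)%E.
move=> F G [z||] F0 G0 FGH H'0 //; last first.
  by rewrite gt0_muley ?lte_fin// mulyy leey.
move: F0 G0 FGH H'0.
case: F => [x||//]; case: G => [y||//];
  try by move=> ? ?; rewrite ?addye ?addey// -EFinM leye_eq.
rewrite -!(EFinM, EFinD) !lee_fin => xx0 yy0 xyz z0.
have -> : a * x * (b * y) = c * c * (x * y) by rewrite cc mulrACA.
rewrite [c * z * _]mulrACA ler_pM2l ?mulr_gt0//.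
have : (x + y) * (x + y) <= (2 * z) * (2 * z) by apply: ler_pM => //; exact: addr_ge0.
have := sqr_ge0 (x - y); rewrite expr2; nra.
Qed.

End prekopa_bounded.

Section prekopa_leindler.
Context {R : realType}.
Local Notation mu := (@lebesgue_measure R).

Definition truncation (f : R -> \bar R) (k : nat) (x : R) : R :=
  fine (mine (f x) k%:R%:E) * \1_`[- k%:R, k%:R] x.

Lemma truncationE (f : R -> \bar R) k x : (0 <= f x)%E ->
  (truncation f k x)%:E =
  if `|x| <= k%:R then mine (f x) k%:R%:E else 0%E.
Proof.
move=> f0; rewrite /truncation indicE ler_norml; case: ifPn => xk.
  rewrite mem_set ?mulr1 ?fineK//= ?in_itv//.
  rewrite fin_real// lt_min ltNyr (lt_le_trans _ f0)//=.
  by rewrite gt_min ltry orbT.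
by rewrite memNset ?mulr0//= in_itv/=; exact/negP.
Qed.

Lemma truncation_cvg (f : R -> \bar R) x : (0 <= f x)%E ->
  (truncation f k x)%:E @[k --> \oo] --> f x.
Proof.
move=> f0; under eq_fun do rewrite truncationE//.
case: (f x) f0 => [r r0|_|//].
- apply: cvg_near_cst.
  near=> k; rewrite ifT; last by near: k; exact: nbhs_infty_ger.
  by apply/min_idPl; rewrite lee_fin; near: k; exact: nbhs_infty_ger.
- apply/cvgeyPge => A; near=> k; rewrite ifT; last by near: k; exact: nbhs_infty_ger.
  rewrite min_r ?leey// lee_fin; near: k; exact: nbhs_infty_ger.
Unshelve. all: by end_near. Qed.

Lemma measurable_truncation (f : R -> \bar R) k :
  measurable_fun setT f -> measurable_fun setT (truncation f k).
Proof.
move=> mf; apply: measurable_funM; last exact: measurable_indic.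
apply: measurableT_comp => //.
exact: measurable_mine.
Qed.

Lemma integral_truncation_cvg (f : R -> \bar R) :
  measurable_fun setT f -> (forall x, 0 <= f x)%E ->
  (\int[mu]_x (truncation f k x)%:E)%E @[k --> \oo] --> (\int[mu]_x f x)%E.
Proof.
move=> mf f0.
rewrite (_ : (\int[mu]_x f x)%E =
   (\int[mu]_x (limn (fun k => (truncation f k x)%:E)))%E); last first.
  by apply: eq_integral => x _; apply/esym/cvg_lim => //; exact: truncation_cvg.
apply: cvg_monotone_convergence => //.
- by move=> k; apply/measurable_EFinP; exact: measurable_truncation.
- by move=> k x _; rewrite truncationE//; case: ifP => // _; rewrite le_min f0 lee_fin ler0n.
- move=> x _ k l kl; rewrite !truncationE//.
  case: ifP => xk; last by case: ifP => // _; rewrite le_min f0 lee_fin ler0n.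
  rewrite ifT ?(le_trans xk) ?ler_nat// le_min !ge_min lexx/=.
  by rewrite lee_fin ler_nat kl orbT.
Qed.

Lemma prekopa_leindler1 (f g h : R -> \bar R) :
  measurable_fun setT f -> measurable_fun setT g -> measurable_fun setT h ->
  (forall x, 0 <= f x)%E -> (forall x, 0 <= g x)%E -> (forall x, 0 <= h x)%E ->
  (forall x y, f x * g y <= h (2^-1 * (x + y))%R * h (2^-1 * (x + y))%R)%E ->
  ((\int[mu]_x f x) * (\int[mu]_x g x) <=
   (\int[mu]_x h x) * (\int[mu]_x h x))%E.
Proof.
move=> mf mg mh f0 g0 h0 fgh.
have H0 : (0 <= \int[mu]_x h x)%E by exact: integral_ge0.
have F0 : (0 <= \int[mu]_x f x)%E by exact: integral_ge0.
have G0 : (0 <= \int[mu]_x g x)%E by exact: integral_ge0.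
have [->|Fn0] := eqVneq (\int[mu]_x f x)%E 0%E; first by rewrite mul0e mule_ge0.
have [->|Gn0] := eqVneq (\int[mu]_x g x)%E 0%E; first by rewrite mule0 mule_ge0.
have FG : ((\int[mu]_x f x) *? (\int[mu]_x g x))%E.
  by rewrite mule_defE (negbTE Fn0) (negbTE Gn0).
have le_tr (u : R -> \bar R) k x : (forall x, 0 <= u x)%E ->
    (0 <= (truncation u k x)%:E <= u x)%E.
  move=> u0; rewrite truncationE//; case: ifP => _; last by rewrite lexx u0.
  by rewrite le_min u0 lee_fin ler0n ge_min lexx.
apply: (cvge_to_le (cvgeM FG (integral_truncation_cvg mf f0)
                             (integral_truncation_cvg mg g0))).
apply: nearW => k.
apply: (@prekopa_leindler1_bounded _ _ _ _ k%:R k%:R) => //;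
  try exact: measurable_truncation.
- move=> x; have /andP[] := le_tr f k x f0; rewrite lee_fin => -> _ /=.
  rewrite -lee_fin truncationE//; case: ifP => _; last by rewrite lee_fin.
  by rewrite ge_min lexx orbT.
- move=> x; apply: contraNT => xk.
  by rewrite -eqe truncationE// (negbTE xk).
- move=> x; have /andP[] := le_tr g k x g0; rewrite lee_fin => -> _ /=.
  rewrite -lee_fin truncationE//; case: ifP => _; last by rewrite lee_fin.
  by rewrite ge_min lexx orbT.
- move=> x; apply: contraNT => xk.
  by rewrite -eqe truncationE// (negbTE xk).
- move=> x y; apply: le_trans (fgh x y); rewrite EFinM.
  have /andP[f1 f2] := le_tr f k x f0; have /andP[g1 g2] := le_tr g k y g0.
  exact: lee_pmul.
Qed.

Lemma prekopa_leindler n (f g h : 'rV[R]_n -> \bar R) :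
  measurable_fun [set: 'rV[R]_n] f -> measurable_fun [set: 'rV[R]_n] g ->
  measurable_fun [set: 'rV[R]_n] h ->
  (forall x, 0 <= f x)%E -> (forall x, 0 <= g x)%E -> (forall x, 0 <= h x)%E ->
  (forall x y, f x * g y <= h (2^-1 *: (x + y))%R * h (2^-1 *: (x + y))%R)%E ->
  ((\int[lebesgue_rV n]_x f x) * (\int[lebesgue_rV n]_x g x) <=
   (\int[lebesgue_rV n]_x h x) * (\int[lebesgue_rV n]_x h x))%E.
Proof.
elim: n f g h => [|n IHn] f g h mf mg mh f0 g0 h0 fgh.
  have E u : (forall x : 'rV[R]_0, 0 <= u x)%E -> (\int[lebesgue_rV 0]_x u x = u 0%R)%E.
    move=> u0; rewrite (eq_integral (cst (u 0))).
      by rewrite integral_cst//= diracT mule1.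
    by move=> x _; congr u; apply/rowP => -[].
  rewrite !E//; apply: le_trans (fgh 0 0) _.
  by rewrite addr0 scaler0.
rewrite !ge0_integral_rVS//.
apply: prekopa_leindler1; try exact: measurable_integral_consr.
1-3: by move=> t; apply: integral_ge0.
move=> s t; apply: IHn => //; try exact: measurable_consr.
move=> x y; apply: le_trans (fgh _ _) _; rewrite cons_rVD.
by rewrite cons_rVZ.
Qed.

End prekopa_leindler.

(** * Bounded measurable functions on a compact set *)

Section borel_rV.
Context {R : realType} {n : nat}.
Implicit Types (A K : set 'rV[R]_n) (x y : 'rV[R]_n).

Lemma measurable_box (A : 'I_n -> set (measurableTypeR R)) : (forall i, measurable (A i)) ->
  measurable [set x : 'rV[R]_n | forall i, A i (x ord0 i)].
Proof.
move=> mA; rewrite [X in measurable X](_ : _ =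
    \bigcap_(i in [set: 'I_n]) (fun x : 'rV[R]_n => x ord0 i) @^-1` A i).
  apply: fin_bigcap_measurable => // i _.
  by rewrite -[X in measurable X]setTI; apply: measurable_coord_rV => //.
by apply/seteqP; split => [x xA i _|x xA i]; exact: xA.
Qed.

Lemma open_measurable_rV A : open A -> measurable A.
Proof.
move=> oA.
pose box (u : 'rV[rat]_n * nat) := [set x : 'rV[R]_n |
  forall i, `]ratr (u.1 ord0 i) - u.2.+1%:R^-1, ratr (u.1 ord0 i) + u.2.+1%:R^-1[%classic (x ord0 i)].
rewrite [A](_ : _ = \bigcup_(u in [set u | box u `<=` A]) box u); last first.
  apply/seteqP; split => [x Ax|x [u /= uA xu]]; last exact: uA.
  have /nbhs_ballP[e /= e0 xeA] : nbhs x A by rewrite nbhsE; exists A.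
  have [k ke] : exists k : nat, 2 * k.+1%:R^-1 < e.
    have [k ke] := ltr_add_invr (divr_gt0 e0 (ltr0n R 2)).
    by exists k; rewrite mulrC -ltr_pdivlMr// -[X in X < _]add0r.
  have k0 : 0 < k.+1%:R^-1 :> R by rewrite invr_gt0.
  have /choice[q qP] : forall i : 'I_n, exists q : rat,
      ratr q \in `]x ord0 i - k.+1%:R^-1, x ord0 i + k.+1%:R^-1[.
    by move=> i; apply: rat_in_itvoo; rewrite ltrBlDr -addrA ltrDl addr_gt0.
  exists (\row_i q i, k).
    move=> y yb; apply: xeA; split => // i j; have -> : i = ord0 by exact: ord1.
    have := yb j; have := qP j; rewrite /= !in_itv/= mxE /ball/= ltr_norml.
    move: ke k0; set d : R := k.+1%:R^-1 => ke k0.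
    move=> /andP[h1 h2] /andP[h3 h4]; apply/andP; split; lra.
  move=> i; rewrite /= in_itv/= mxE; have := qP i; rewrite in_itv/=.
  move: k0; set d : R := k.+1%:R^-1 => k0 /andP[h1 h2].
  by apply/andP; split; lra.
rewrite bigcup_mkcond; apply: countable_bigcupT_measurable.
  exact: countableP.
move=> u; case: ifP => // _; pose I (i : 'I_n) : set (measurableTypeR R) :=
  `]ratr (u.1 ord0 i) - u.2.+1%:R^-1, ratr (u.1 ord0 i) + u.2.+1%:R^-1[%classic.
by apply: (@measurable_box I) => i; rewrite /I; exact: measurable_itv.
Qed.

Lemma closed_measurable_rV A : closed A -> measurable A.
Proof.
move=> cA; rewrite -(setCK A); apply: measurableC; apply: open_measurable_rV.
exact: closed_openC.
Qed.

Lemma compact_measurable_rV K : compact K -> measurable K.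
Proof.
by move=> cK; apply: closed_measurable_rV; exact: compact_closed.
Qed.

Lemma compact_coord_bounded K : compact K ->
  exists M : R, forall x, K x -> forall i, `|x ord0 i| <= M.
Proof.
move=> /compact_bounded[M [_ MK]]; exists (M + 1) => x Kx i.
apply: le_trans (MK (M + 1) _ x Kx); last by rewrite ltrDl.
by rewrite [leRHS]/Num.norm/= mx_normrE; apply/bigmax_geP; right; exists (ord0, i).
Qed.

Lemma compact_lebesgue_lty K : compact K -> (lebesgue_rV n K < +oo)%E.
Proof.
move=> cK; have [M MK] := compact_coord_bounded cK.
pose I (i : 'I_n) : set (measurableTypeR R) := `[- M, M]%classic.
have mI i : measurable (I i) by exact: measurable_itv.
apply: (@le_lt_trans _ _
    (lebesgue_rV n [set x : 'rV[R]_n | forall i, I i (x ord0 i)])).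
  apply: le_measure; rewrite ?inE; first exact: compact_measurable_rV.
    exact: measurable_box.
  by move=> x Kx i; rewrite /I /= in_itv/= -ler_norml MK.
rewrite lebesgue_rV_prod//.
under eq_bigr do rewrite lebesgue_measure_itv/= -EFinB.
rewrite (eq_bigr (fun=> (if - M < M then M - - M else 0)%:E)).
  by rewrite prodEFin ltry.
by move=> i _; rewrite lte_fin; case: ifP.
Qed.

End borel_rV.

Lemma convex_setP (R : realType) n (K : set 'rV[R]_n) x y (t : R) :
  convex_set K -> K x -> K y -> 0 <= t <= 1 -> K (t *: x + (1 - t) *: y).
Proof.
move=> cK Kx Ky /andP[t0 t1].
have := cK x y (Itv01 t0 t1); rewrite !inE => /(_ Kx Ky).
by [].
Qed.

Section bounded_measurable.
Context {R : realType} {n : nat} (K : set 'rV[R]_n).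
Hypothesis cK : compact K.
Implicit Types f g : 'rV[R]_n -> R.

Definition bmeas f := measurable_fun [set: 'rV[R]_n] f /\
  exists M, forall x, K x -> `|f x| <= M.

Lemma bmeas_cst c : bmeas (fun=> c).
Proof. by split; [exact: measurable_cst|exists `|c|]. Qed.

Lemma bmeas_coord i : bmeas (fun x => x ord0 i).
Proof.
split; first exact: measurable_coord_rV.
by have [M MK] := compact_coord_bounded cK; exists M => x Kx; exact: MK.
Qed.

Lemma bmeasD f g : bmeas f -> bmeas g -> bmeas (fun x => f x + g x).
Proof.
move=> [mf [M Mf]] [mg [N Ng]]; split; first exact: measurable_funD.
exists (M + N) => x Kx; apply: le_trans (ler_normD _ _) _.
by rewrite lerD ?Mf ?Ng.
Qed.

Lemma bmeasM f g : bmeas f -> bmeas g -> bmeas (fun x => f x * g x).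
Proof.
move=> [mf [M Mf]] [mg [N Ng]]; split; first exact: measurable_funM.
by exists (M * N) => x Kx; rewrite normrM ler_pM ?Mf ?Ng.
Qed.

Lemma bmeasZ c f : bmeas f -> bmeas (fun x => c * f x).
Proof. by move=> bf; apply: bmeasM => //; exact: bmeas_cst. Qed.

Lemma bmeasN f : bmeas f -> bmeas (fun x => - f x).
Proof.
by move=> bf; under eq_fun do rewrite -mulN1r; exact: bmeasZ.
Qed.

Lemma bmeasB f g : bmeas f -> bmeas g -> bmeas (fun x => f x - g x).
Proof. by move=> bf bg; apply: bmeasD => //; exact: bmeasN. Qed.

Lemma bmeasX f k : bmeas f -> bmeas (fun x => f x ^+ k).
Proof.
move=> bf; elim: k => [|k IHk]; first exact: bmeas_cst.
by under eq_fun do rewrite exprS; exact: bmeasM.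
Qed.

Lemma bmeas_sum (I : Type) (r : seq I) (F : I -> 'rV[R]_n -> R) :
  (forall i, bmeas (F i)) -> bmeas (fun x => \sum_(i <- r) F i x).
Proof.
move=> bF; elim: r => [|i r IHr].
  by under eq_fun do rewrite big_nil; exact: bmeas_cst.
by under eq_fun do rewrite big_cons; exact: bmeasD.
Qed.

Lemma bmeas_dot u : bmeas (fun x => dot x u).
Proof.
by apply: bmeas_sum => i; apply: bmeasM; [exact: bmeas_coord|exact: bmeas_cst].
Qed.

Lemma bmeas_dotxx : bmeas (fun x => dot x x).
Proof. by apply: bmeas_sum => i; apply: bmeasM; exact: bmeas_coord. Qed.

Lemma bmeas_indic (A : set 'rV[R]_n) : measurable A -> bmeas (\1_A).
Proof.
move=> mA; split; first exact: measurable_indic.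
by exists 1 => x _; rewrite indicE; case: (_ \in _); rewrite ?normr0 ?normr1.
Qed.

Local Notation mK := (compact_measurable_rV cK).

Lemma bmeas_integrable f : bmeas f ->
  (lebesgue_rV n).-integrable K (EFin \o f).
Proof.
move=> [mf [M Mf]]; apply: measurable_bounded_integrable.
- exact: mK.
- exact: compact_lebesgue_lty.
- exact: measurable_funTS.
- exists M; split; first exact: num_real.
  by move=> N MN x /= Kx; rewrite (le_trans (Mf x Kx))// ltW.
Qed.

Local Notation "\int f" := (\int[lebesgue_rV n]_(x in K) f x)
  (at level 36, f at level 36).

Lemma bint_ge0 f : (forall x, K x -> 0 <= f x) -> 0 <= \int f.
Proof. exact: Rintegral_ge0. Qed.

Lemma bint_le f g : bmeas f -> bmeas g -> (forall x, K x -> f x <= g x) ->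
  \int f <= \int g.
Proof.
by move=> bf bg; apply: le_Rintegral; [exact: mK|exact: bmeas_integrable..].
Qed.

Lemma bintD f g : bmeas f -> bmeas g -> \int (fun x => f x + g x) = \int f + \int g.
Proof.
by move=> bf bg; apply: RintegralD; [exact: mK|exact: bmeas_integrable..].
Qed.

Lemma bintB f g : bmeas f -> bmeas g -> \int (fun x => f x - g x) = \int f - \int g.
Proof.
by move=> bf bg; apply: RintegralB; [exact: mK|exact: bmeas_integrable..].
Qed.

Lemma bintZ c f : bmeas f -> \int (fun x => c * f x) = c * \int f.
Proof.
by move=> bf; apply: RintegralZl; [exact: mK|exact: bmeas_integrable].
Qed.

Lemma bint_cst c : \int (fun=> c) = c * vol K.
Proof. exact: Rintegral_cst mK c. Qed.

Lemma bint_sum (I : Type) (r : seq I) (F : I -> 'rV[R]_n -> R) :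
  (forall i, bmeas (F i)) ->
  \int (fun x => \sum_(i <- r) F i x) = \sum_(i <- r) \int (F i).
Proof.
move=> bF; elim: r => [|i r IHr].
  rewrite big_nil -[RHS](mul0r (vol K)) -bint_cst.
  by apply: eq_Rintegral => x _; rewrite big_nil.
rewrite big_cons -IHr -bintD//; last exact: bmeas_sum.
by apply: eq_Rintegral => x _; rewrite big_cons.
Qed.

Lemma bint_dot u : \int (fun x => dot x u) = dot (vintegral K) u.
Proof.
rewrite bint_sum; last first.
  by move=> i; apply: bmeasM; [exact: bmeas_coord|exact: bmeas_cst].
apply: eq_bigr => i _; rewrite mxE [RHS]mulrC -bintZ; last exact: bmeas_coord.
by apply: eq_Rintegral => x _; rewrite mulrC.
Qed.

Lemma bint_patch f : bmeas f ->
  (\int[lebesgue_rV n]_x ((f \_ K) x)%:E)%E = (\int f)%:E.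
Proof.
move=> bf; rewrite /Rintegral fineK; last first.
  by apply: integrable_fin_num; [exact: mK|exact: bmeas_integrable].
by rewrite [RHS]integral_mkcond restrict_EFin.
Qed.

Lemma bint_prekopa f g h : convex_set K -> bmeas f -> bmeas g -> bmeas h ->
  (forall x, 0 <= f x) -> (forall x, 0 <= g x) -> (forall x, 0 <= h x) ->
  (forall x y, K x -> K y -> f x * g y <= h (2^-1 *: (x + y)) ^+ 2) ->
  \int f * \int g <= (\int h) ^+ 2.
Proof.
move=> convK bf bg bh f0 g0 h0 fgh.
rewrite -lee_fin EFinM expr2 EFinM -!bint_patch//.
have mpatch u : bmeas u -> measurable_fun [set: 'rV[R]_n] (fun x => ((u \_ K) x)%:E).
  move=> bu; apply/measurable_EFinP; apply/(measurable_restrictT u mK).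
  by apply: measurable_funTS; case: bu.
have patch0 (u : 'rV[R]_n -> R) : (forall x, 0 <= u x) -> forall x, (0 <= ((u \_ K) x)%:E)%E.
  by move=> u0 x; rewrite lee_fin patchE; case: ifP.
apply: prekopa_leindler; [exact: mpatch..|exact: patch0|exact: patch0|exact: patch0|].
move=> x y; rewrite -!EFinM lee_fin !patchE.
case: ifPn => xK; last by rewrite mul0r; case: ifP => _; rewrite ?mul0r ?mulr_ge0.
case: ifPn => yK; last by rewrite mulr0; case: ifP => _; rewrite ?mul0r ?mulr_ge0.
rewrite ifT; first by rewrite -expr2 fgh//; exact: set_mem.
rewrite inE scalerDr.
have {2}-> : 2^-1 = 1 - 2^-1 :> R by field.
apply: convex_setP => //; [exact: set_mem..|].
by rewrite invr_ge0 ler0n invf_le1 ?ltr0n// ler1n.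
Qed.

End bounded_measurable.

(** * The fourth moment inequality *)

Section dot_theory.
Context {R : realType} {n : nat}.
Implicit Types x y z : 'rV[R]_n.

Lemma dotC x y : dot x y = dot y x.
Proof. by apply: eq_bigr => i _; rewrite mulrC. Qed.

Lemma dotDl x y z : dot (x + y) z = dot x z + dot y z.
Proof. by rewrite -big_split; apply: eq_bigr => i _; rewrite mxE mulrDl. Qed.

Lemma dotZl a x z : dot (a *: x) z = a * dot x z.
Proof. by rewrite [RHS]mulr_sumr; apply: eq_bigr => i _; rewrite mxE mulrA. Qed.

Lemma dotDr x y z : dot z (x + y) = dot z x + dot z y.
Proof. by rewrite dotC dotDl !(dotC z). Qed.

Lemma dotZr a x z : dot z (a *: x) = a * dot z x.
Proof. by rewrite dotC dotZl (dotC z). Qed.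

Lemma dotNl x z : dot (- x) z = - dot x z.
Proof. by rewrite -scaleN1r dotZl mulN1r. Qed.

Lemma dotNr x z : dot z (- x) = - dot z x.
Proof. by rewrite dotC dotNl dotC. Qed.

Lemma dotBl x y z : dot (x - y) z = dot x z - dot y z.
Proof. by rewrite dotDl dotNl. Qed.

Lemma dotBr x y z : dot z (x - y) = dot z x - dot z y.
Proof. by rewrite dotDr dotNr. Qed.

Lemma dot0l x : dot 0 x = 0.
Proof. by rewrite -(scale0r x) dotZl mul0r. Qed.

Lemma dot0r x : dot x 0 = 0.
Proof. by rewrite dotC dot0l. Qed.

Lemma dotxx_ge0 x : 0 <= dot x x.
Proof. by apply: sumr_ge0 => i _; rewrite -expr2 sqr_ge0. Qed.

Lemma dotxx_eq0 x : (dot x x == 0) = (x == 0).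
Proof.
apply/eqP/eqP => [|->]; last exact: dot0l.
move=> /eqP; rewrite psumr_eq0 => [/allP x0|i _]; last by rewrite -expr2 sqr_ge0.
apply/rowP => i; rewrite mxE; apply/eqP; have := x0 i; rewrite mem_index_enum.
by move=> /(_ isT); rewrite mulf_eq0 orbb.
Qed.

Lemma dotxx_gt0 x : (0 < dot x x) = (x != 0).
Proof. by rewrite lt_neqAle dotxx_ge0 andbT eq_sym dotxx_eq0. Qed.

Lemma dot_delta x i : dot x (delta_mx ord0 i) = x ord0 i.
Proof.
rewrite /dot (bigD1 i)//= mxE !eqxx mulr1 big1 ?addr0// => j ji.
by rewrite mxE (negbTE ji) andbF mulr0.
Qed.

End dot_theory.

Section fourth_moment.
Context {R : realType} {n : nat} (K : set 'rV[R]_n).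
Hypotheses (cK : compact K) (convK : convex_set K) (volK : vol K = 1).

Lemma fourth_moment_le (theta : 'rV[R]_n) (s : R) : 0 < s ->
  \int[lebesgue_rV n]_(x in K) dot x theta ^+ 2 = s ^+ 2 ->
  \int[lebesgue_rV n]_(x in K) dot x theta ^+ 4 <= 144 * s ^+ 4.
Proof.
move=> s0 Es.
pose l x := dot x theta.
have bl : bmeas K l by exact: bmeas_dot.
have bl2 : bmeas K (fun x => l x ^+ 2) by exact: bmeasX.
have bl4 : bmeas K (fun x => l x ^+ 4) by exact: bmeasX.
have ml : measurable_fun [set: 'rV[R]_n] (fun x => `|l x|).
  by apply: measurableT_comp => //; case: bl.
pose A := [set x | 6 * s <= `|l x|]; pose B := [set x | `|l x| <= 2 * s].
have mA : measurable A.
  have : measurable_fun [set: 'rV[R]_n] (fun x => 6 * s <= `|l x|).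
    exact: measurable_fun_ler.
  by move=> /(_ measurableT [set true]); rewrite setTI; exact.
have mB : measurable B.
  have : measurable_fun [set: 'rV[R]_n] (fun x => `|l x| <= 2 * s).
    exact: measurable_fun_ler.
  by move=> /(_ measurableT [set true]); rewrite setTI; exact.
have bA : bmeas K (fun x => l x ^+ 4 * \1_A x) by apply: bmeasM => //; exact: bmeas_indic.
have bB : bmeas K (\1_B : _ -> R) by exact: bmeas_indic.
have PL := bint_prekopa cK convK bA bB (bmeasZ 9 bl2).
have {PL} : (\int[lebesgue_rV n]_(x in K) (l x ^+ 4 * \1_A x)) *
     (\int[lebesgue_rV n]_(x in K) (\1_B x)) <= 81 * s ^+ 4.
  apply: le_trans (PL _ _ _ _) _.
  - by move=> x; rewrite mulr_ge0// (exprM _ 2 2) sqr_ge0.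
  - by move=> x.
  - by move=> x; rewrite mulr_ge0// sqr_ge0.
  - move=> x y _ _.
    have [xA|xA] := boolP (x \in A); last by rewrite !indicE (negbTE xA) mulr0 mul0r sqr_ge0.
    have [yB|yB] := boolP (y \in B); last by rewrite !indicE (negbTE yB) mulr0 sqr_ge0.
    rewrite !indicE xA yB !mulr1 /l dotZl dotDl -/(l x) -/(l y).
    move: xA yB; rewrite !inE /A /B/=.
    move: (l x) (l y) => a b ha hb.
    have {ha hb} : `|a| <= `|3 * (2^-1 * (a + b))|.
      rewrite !normrM gtr0_norm// gtr0_norm ?invr_gt0//.
      have := lerB_normD a b; lra.
    rewrite -ler_sqr ?nnegrE// !real_normK ?num_real// => h.
    have -> : 9 * (2^-1 * (a + b)) ^+ 2 = (3 * (2^-1 * (a + b))) ^+ 2 by ring.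
    by rewrite (exprM a 2 2) lerXn2r ?nnegrE ?sqr_ge0.
  - by rewrite bintZ// Es; lra.
have : 3 / 4 <= \int[lebesgue_rV n]_(x in K) (\1_B x).
  have <- : \int[lebesgue_rV n]_(x in K) (1 - (4 * s ^+ 2)^-1 * l x ^+ 2) = 3 / 4.
    rewrite bintB//; [|exact: bmeas_cst|exact: bmeasZ].
    rewrite bint_cst// bintZ// Es volK; field.
    by rewrite gt_eqF.
  apply: bint_le => //; first by apply: bmeasB; [exact: bmeas_cst|exact: bmeasZ].
  move=> x _; rewrite indicE; case: (boolP (x \in B)) => xB.
    by rewrite gerBl mulr_ge0 ?sqr_ge0// invr_ge0 mulr_ge0 ?sqr_ge0.
  rewrite subr_le0 ler_pdivlMl ?mulr_gt0 ?exprn_gt0// mulr1.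
  move: xB; rewrite notin_setE /B/= => /negP; rewrite -ltNge => xB.
  have := ltW xB; rewrite -ler_sqr ?nnegrE ?mulr_ge0 ?(ltW s0)//.
  by rewrite real_normK ?num_real// exprMn; lra.
set EA := \int[_]_(x in K) (_ * \1_A x); set EB := \int[_]_(x in K) (\1_B x).
move=> hB hAB.
have EA0 : 0 <= EA.
  by apply: bint_ge0 => x _; rewrite mulr_ge0// (exprM _ 2 2) sqr_ge0.
have hA : EA <= 108 * s ^+ 4 by nra.
apply: (@le_trans _ _ (EA + 36 * s ^+ 2 * s ^+ 2)); last by lra.
rewrite -[X in _ <= EA + _ * X]Es -bintZ// -bintD//; last exact: bmeasZ.
apply: bint_le => //; first by apply: bmeasD => //; exact: bmeasZ.
move=> x _; rewrite indicE; case: (boolP (x \in A)) => xA.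
  by rewrite mulr1 lerDl mulr_ge0 ?sqr_ge0// mulr_ge0 ?sqr_ge0.
rewrite mulr0 add0r; move: xA; rewrite notin_setE /A/= => /negP; rewrite -ltNge => xA.
have := ltW xA; rewrite -ler_sqr ?nnegrE ?mulr_ge0 ?(ltW s0)//.
rewrite real_normK ?num_real// exprMn => h.
by rewrite (exprD (l x) 2 2) ler_wpM2r ?sqr_ge0//; lra.
Qed.

End fourth_moment.

(** * Points of an isotropic convex body *)

Section separation.
Context {R : realType} {n : nat} (K : set 'rV[R]_n).
Hypotheses (cK : compact K) (convK : convex_set K).

Lemma continuous_dist2 (p : 'rV[R]_n) :
  continuous (fun x : 'rV[R]_n => dot (x - p) (x - p)).
Proof.
rewrite /dot => x; elim: (index_enum _) => [|i r IHr].
  by under eq_fun do rewrite big_nil; exact: cst_continuous.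
have cx : (fun y : 'rV[R]_n => y ord0 i) @ x --> x ord0 i.
  exact: coord_continuous.
have ci : (fun y : 'rV[R]_n => y ord0 i - p ord0 i) @ x --> x ord0 i - p ord0 i.
  by apply: (cvgB cx); exact: cvg_cst.
have cii : (fun y : 'rV[R]_n => (y ord0 i - p ord0 i) * (y ord0 i - p ord0 i)) @ x
    --> (x ord0 i - p ord0 i) * (x ord0 i - p ord0 i).
  by apply: (cvgM ci ci).
rewrite (_ : (fun _ => _) = (fun y : 'rV[R]_n =>
    (y ord0 i - p ord0 i) * (y ord0 i - p ord0 i) +
    \sum_(j <- r) (y - p) ord0 j * (y - p) ord0 j)).
  by apply: (cvgD cii IHr).
by apply/funext => y; rewrite big_cons !mxE.
Qed.

Lemma continuous_dot (u : 'rV[R]_n) : continuous (fun x : 'rV[R]_n => dot x u).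
Proof.
rewrite /dot => x; elim: (index_enum _) => [|i r IHr].
  by under eq_fun do rewrite big_nil; exact: cst_continuous.
have cx : (fun y : 'rV[R]_n => y ord0 i) @ x --> x ord0 i.
  exact: coord_continuous.
have ci : (fun y : 'rV[R]_n => y ord0 i * u ord0 i) @ x --> x ord0 i * u ord0 i.
  by apply: (cvgM cx); exact: cvg_cst.
rewrite (_ : (fun _ => _) = (fun y : 'rV[R]_n => y ord0 i * u ord0 i +
    \sum_(j <- r) y ord0 j * u ord0 j)).
  by apply: (cvgD ci IHr).
by apply/funext => y; rewrite big_cons.
Qed.

(* The normal vector is p - q, where q is the point of K nearest to p. *)
Lemma separation (p : 'rV[R]_n) : K !=set0 -> ~ K p ->
  exists theta, forall x, K x -> dot x theta < dot p theta.
Proof.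
move=> K0 Kp.
have [|q /set_mem Kq qmin] := EVT_min_rV K0 cK (f := fun x : 'rV[R]_n => dot (x - p) (x - p)).
  by apply: continuous_subspaceT; exact: continuous_dist2.
exists (p - q) => x Kx.
have pq : 0 < dot (p - q) (p - q).
  by rewrite dotxx_gt0 subr_eq0; apply: contra_not_neq Kp => ->.
suff : dot (x - q) (p - q) <= 0 by rewrite dotBl => h; rewrite dotBl in pq; lra.
rewrite leNgt; apply/negP => xq.
set a := dot (x - q) (p - q) in xq.
set b := dot (x - q) (x - q).
have b0 : 0 <= b by exact: dotxx_ge0.
pose t := a / (a + b).
have ab0 : 0 < a + b by lra.
have t01 : 0 < t <= 1 by rewrite divr_gt0//= ler_pdivrMr// mul1r lerDl.
have /qmin : (t *: x + (1 - t) *: q) \in K.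
  by rewrite inE; apply: convex_setP => //; lra.
have -> : t *: x + (1 - t) *: q - p = t *: (x - q) - (p - q).
    by apply/rowP => i; rewrite !mxE; ring.
have E y z : dot (t *: y - z) (t *: y - z) = t ^+ 2 * dot y y - 2 * t * dot y z + dot z z.
  by rewrite dotBl !dotBr !dotZl !dotZr (dotC z y); ring.
rewrite -opprB dotNl dotNr opprK E -/a -/b.
have h : t * (a + b) = a by rewrite divfK ?gt_eqF.
by case/andP: t01 => t0 t1; nra.
Qed.

End separation.

Lemma dot_normalize (R : realType) n (x : 'rV[R]_n) : x != 0 ->
  exists N u, [/\ 0 < N, x = N *: u & dot u u = 1].
Proof.
rewrite -dotxx_gt0 => x0; pose N : R := Num.sqrt (dot x x).
have N0 : 0 < N by rewrite sqrtr_gt0.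
have NN : N ^+ 2 = dot x x by rewrite sqr_sqrtr// ltW.
exists N, (N^-1 *: x); split => //.
  by rewrite scalerA mulfV ?scale1r// gt_eqF.
by rewrite dotZl dotZr -NN; field; rewrite gt_eqF.
Qed.

Section isotropic.
Context {R : realType} {n : nat} (K : set 'rV[R]_n) (L : R).
Hypotheses (n0 : (0 < n)%N) (cK : compact K) (convK : convex_set K).
Hypotheses (volK : vol K = 1) (baryK : vintegral K = 0) (L0 : 0 < L).
Hypothesis isoK : forall theta, dot theta theta = 1 ->
  \int[lebesgue_rV n]_(x in K) (dot x theta) ^+ 2 = L ^+ 2.

Let bdot u : bmeas K (fun x => dot x u) := bmeas_dot cK u.
Let bdotX u k : bmeas K (fun x => dot x u ^+ k).
Proof. exact/bmeasX/bdot. Qed.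

Let int0 : \int[lebesgue_rV n]_(x in K) (0 : R) = 0.
Proof. by rewrite bint_cst// mul0r. Qed.

Let bdotXX u v k l : bmeas K (fun x => dot x u ^+ k * dot x v ^+ l).
Proof. exact: bmeasM. Qed.

Lemma isotropic_second_moment theta :
  \int[lebesgue_rV n]_(x in K) (dot x theta) ^+ 2 = L ^+ 2 * dot theta theta.
Proof.
have [->|] := eqVneq theta 0.
  rewrite dot0l mulr0 -[RHS]int0.
  by apply: eq_Rintegral => x _; rewrite dot0r expr0n.
move=> /dot_normalize[N [u [N0 -> u1]]].
rewrite dotZl dotZr u1 mulr1 -expr2 mulrC -(isoK u1) -bintZ//.
by apply: eq_Rintegral => x _; rewrite dotZr exprMn.
Qed.

Lemma isotropic_fourth_moment theta :
  \int[lebesgue_rV n]_(x in K) (dot x theta) ^+ 4 <=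
  144 * L ^+ 4 * dot theta theta ^+ 2.
Proof.
have [->|] := eqVneq theta 0.
  rewrite dot0l [in leRHS]expr0n mulr0 -[leRHS]int0 le_eqVlt; apply/orP; left.
  by apply/eqP/eq_Rintegral => x _; rewrite dot0r expr0n.
move=> /dot_normalize[N [u [N0 -> u1]]].
rewrite dotZl dotZr u1 mulr1 -expr2 -exprM mulrC.
apply: le_trans (_ : N ^+ 4 * \int[lebesgue_rV n]_(x in K) (dot x u ^+ 4) <= _).
  rewrite -bintZ// le_eqVlt; apply/orP; left; apply/eqP/eq_Rintegral => x _.
  by rewrite dotZr exprMn.
rewrite ler_pM2l ?exprn_gt0//.
by apply: fourth_moment_le => //; exact: isoK.
Qed.

Lemma isotropic_mixed_moment u v :
  \int[lebesgue_rV n]_(x in K) (dot x u ^+ 2 * dot x v ^+ 2) <=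
  144 * L ^+ 4 * (dot u u * dot v v).
Proof.
have [->|] := eqVneq u 0.
  rewrite dot0l mul0r mulr0 -[leRHS]int0 le_eqVlt; apply/orP; left.
  by apply/eqP/eq_Rintegral => x _; rewrite dot0r expr0n mul0r.
move=> /dot_normalize[N [u' [N0 -> u1]]].
have [->|] := eqVneq v 0.
  rewrite dot0l !mulr0 -[leRHS]int0 le_eqVlt; apply/orP; left.
  by apply/eqP/eq_Rintegral => x _; rewrite dot0r [in X in _ * X]expr0n mulr0.
move=> /dot_normalize[M [v' [M0 -> v1]]].
rewrite !dotZl !dotZr u1 v1 !mulr1.
apply: (@le_trans _ _ (\int[lebesgue_rV n]_(x in K)
    ((N ^+ 2 * M ^+ 2) * (2^-1 * (dot x u' ^+ 4 + dot x v' ^+ 4))))).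
  apply: bint_le => //; first by apply: bmeasZ; apply: bmeasZ; exact: bmeasD.
  move=> x _; rewrite !dotZr !exprMn mulrACA ler_wpM2l//.
    by rewrite mulr_ge0 // exprn_ge0 // ltW.
  have := sqr_ge0 (dot x u' ^+ 2 - dot x v' ^+ 2).
  have e4 (a : R) : a ^+ 4 = a ^+ 2 * a ^+ 2 by rewrite -exprD.
  by rewrite !e4; nra.
rewrite bintZ; [|exact: cK|by apply: bmeasZ; exact: bmeasD].
rewrite bintZ//; last exact: bmeasD.
rewrite bintD// mulrC -!expr2 ler_pM2r ?mulr_gt0 ?exprn_gt0//.
have := isotropic_fourth_moment u'; have := isotropic_fourth_moment v'.
by rewrite u1 v1 expr1n mulr1; lra.
Qed.

Lemma isotropic_contains_ball p : dot p p < (L / 68) ^+ 2 -> K p.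
Proof.
move=> pL; apply: contrapT => Kp.
have K0 : K !=set0.
  apply/set0P/negP => /eqP KE; move: volK.
  by rewrite KE /vol measure0 => /esym/eqP; rewrite oner_eq0.
have [theta Ht] := separation cK convK K0 Kp.
have : theta != 0.
  by apply: contraPneq Ht => -> H; have [x /H] := K0; rewrite !dot0r ltxx.
move=> /dot_normalize[N [u [N0 tE u1]]].
pose rho := dot p u.
have lu x : K x -> dot x u < rho.
  by move=> /Ht; rewrite tE !dotZr ltr_pM2l.
have rho_p : rho ^+ 2 <= dot p p.
  have := dotxx_ge0 (p - rho *: u).
  by rewrite dotBl !dotBr !dotZl !dotZr u1 (dotC u) -/rho; lra.
have rho0 : 0 <= rho.
  rewrite -(dot0l u) -baryK -(bint_dot cK) -[leRHS]mulr1 -volK -bint_cst//.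
  by apply: bint_le => //; [exact: bmeas_cst|move=> x Kx; exact/ltW/lu].
have [A A0 AE] : exists2 A : R, 0 < A & A = 17 * L.
  by exists (17 * L) => //; rewrite mulr_gt0.
have A20 : 0 < A ^+ 2 by rewrite exprn_gt0.
have : L ^+ 2 <= A * (2 * rho) + (A ^+ 2)^-1 * (144 * L ^+ 4).
  rewrite -{1}(isoK u1).
  apply: (@le_trans _ _ (\int[lebesgue_rV n]_(x in K)
      ((A * (2 * rho) - A * dot x u) + (A ^+ 2)^-1 * dot x u ^+ 4))).
    apply: bint_le => //.
      apply: bmeasD; last exact: bmeasZ.
      by apply: bmeasB; [exact: bmeas_cst|exact: bmeasZ].
    move=> x /lu; set l := dot x u => lrho.
    have l4 : l ^+ 4 = l ^+ 2 * l ^+ 2 by rewrite -exprD.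
    have l40 : 0 <= l ^+ 4 by rewrite l4 -expr2 sqr_ge0.
    have [lL|lL] := leP (`|l|) A.
      have h1 : 0 <= (A ^+ 2)^-1 * l ^+ 4 by rewrite mulr_ge0// invr_ge0 ltW.
      apply: (@le_trans _ _ (A * (2 * rho) - A * l)); last by rewrite lerDl.
      rewrite -mulrBr -real_normK ?num_real// expr2.
      apply: ler_pM => //.
      by have [l0|l0] := leP 0 l; [rewrite ger0_norm//|rewrite ltr0_norm//]; lra.
    have h1 : 0 <= A * (2 * rho) - A * l.
      by rewrite -mulrBr mulr_ge0//; [exact: ltW|lra].
    apply: (@le_trans _ _ ((A ^+ 2)^-1 * l ^+ 4)); last by rewrite lerDr.
    rewrite ler_pdivlMl// l4 ler_wpM2r ?sqr_ge0//.
    rewrite -[leRHS]real_normK ?num_real//.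
    by apply: lerXn2r; rewrite ?nnegrE ?(ltW lL)// ltW.
  rewrite bintD//; last 2 first.
    by apply: bmeasB; [exact: bmeas_cst|exact: bmeasZ].
    exact: bmeasZ.
  rewrite bintB//; [|exact: bmeas_cst|exact: bmeasZ].
  rewrite bint_cst// volK mulr1 !bintZ// bint_dot// baryK dot0l mulr0 subr0 lerD2l.
  rewrite ler_pM2l ?invr_gt0//.
  by have := isotropic_fourth_moment u; rewrite u1 expr1n mulr1.
have -> : (A ^+ 2)^-1 * (144 * L ^+ 4) = 144 / 289 * L ^+ 2.
  by rewrite AE; field; rewrite gt_eqF.
rewrite AE => H.
have H1 : L * L <= L * (68 * rho).
  rewrite expr2 (_ : 17 * L * (2 * rho) = 34 * (L * rho)) in H; last by ring.
  rewrite (_ : L * (68 * rho) = 68 * (L * rho)); last by ring.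
  have : 0 <= L * L by rewrite mulr_ge0// ltW.
  move: (L * L) (L * rho) H => a b H a0.
  lra.
have : L / 68 <= rho.
  by rewrite ler_pdivrMr// mulrC -(ler_pM2l L0).
have L68 : 0 <= L / 68 by rewrite divr_ge0// ltW.
rewrite -ler_sqr ?nnegrE// => H'.
by have := lt_le_trans (le_lt_trans rho_p pL) H'; rewrite ltxx.
Qed.

Lemma isotropic_good_point (s : seq 'rV[R]_n) (u : 'rV[R]_n) :
  0 < \sum_(theta <- s) dot theta theta ->
  exists x, [/\ K x,
    L ^+ 2 / 4 * \sum_(theta <- s) dot theta theta <=
      \sum_(theta <- s) dot x theta ^+ 2,
    dot x u ^+ 2 <= 576 * L ^+ 2 * dot u u &
    dot x x <= 576 * L ^+ 2 * n%:R].
Proof.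
set T := \sum_(theta <- s) dot theta theta => T0.
apply: contrapT => /forallNP H.
pose q x := \sum_(theta <- s) dot x theta ^+ 2.
have bq : bmeas K q by apply: bmeas_sum => theta; exact: bdotX.
have q0 x : 0 <= q x by apply: sumr_ge0 => theta _; exact: sqr_ge0.
have Eq : \int[lebesgue_rV n]_(x in K) q x = L ^+ 2 * T.
  rewrite bint_sum// mulr_sumr; apply: eq_bigr => theta _.
  exact: isotropic_second_moment.
have Equ v : \int[lebesgue_rV n]_(x in K) (q x * dot x v ^+ 2) <= 144 * L ^+ 4 * (T * dot v v).
  rewrite (_ : \int[_]_(x in K) _ =
     \int[lebesgue_rV n]_(x in K) (\sum_(theta <- s) dot x theta ^+ 2 * dot x v ^+ 2)).
    rewrite bint_sum// mulr_suml mulr_sumr; apply: ler_sum => theta _.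
    exact: isotropic_mixed_moment.
  by apply: eq_Rintegral => x _; rewrite /q mulr_suml.
have bqu v : bmeas K (fun x => q x * dot x v ^+ 2) by exact: bmeasM.
have Eqx : \int[lebesgue_rV n]_(x in K) (q x * dot x x) <= 144 * L ^+ 4 * (T * n%:R).
  rewrite (_ : \int[_]_(x in K) _ = \int[lebesgue_rV n]_(x in K)
      (\sum_(i < n) q x * dot x (delta_mx ord0 i) ^+ 2)).
    rewrite bint_sum//.
    apply: le_trans (_ : \sum_(i < n) 144 * L ^+ 4 * (T * 1) <= _).
      apply: ler_sum => i _; have := Equ (delta_mx ord0 i).
      by rewrite dot_delta mxE !eqxx.
    by rewrite sumr_const card_ord mulr1 -[leLHS]mulr_natr -[leLHS]mulrA.
  apply: eq_Rintegral => x _; rewrite {1}[dot x x]/dot mulr_sumr; apply: eq_bigr => i _.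
  by rewrite dot_delta expr2.
have bqx : bmeas K (fun x => q x * dot x x) by apply: bmeasM => //; exact: bmeas_dotxx.
have [D D0 DE] : exists2 D : R, 0 < D & D = 576 * L ^+ 2.
  exists (576 * L ^+ 2); last by [].
  by apply: mulr_gt0; [rewrite ltr0n|exact: exprn_gt0].
rewrite -DE in H.
pose c1 := (D * dot u u)^-1; pose c2 := (D * n%:R)^-1.
have nR : 0 < n%:R :> R by rewrite ltr0n.
have c10 : 0 <= c1 by rewrite invr_ge0 mulr_ge0 ?dotxx_ge0// ltW.
have c20 : 0 <= c2 by rewrite invr_ge0 mulr_ge0// ltW.
have : \int[lebesgue_rV n]_(x in K) q x <= \int[lebesgue_rV n]_(x in K)
    (L ^+ 2 / 4 * T + (c1 * (q x * dot x u ^+ 2) + c2 * (q x * dot x x))).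
  apply: bint_le => //.
    by apply: bmeasD; [exact: bmeas_cst|apply: bmeasD; exact: bmeasZ].
  move=> x Kx.
  have LT0 : 0 <= L ^+ 2 / 4 * T by apply: mulr_ge0; [rewrite divr_ge0// exprn_ge0// ltW|exact: ltW].
  have a0 : 0 <= c1 * (q x * dot x u ^+ 2).
    by apply: mulr_ge0 => //; apply: mulr_ge0 => //; exact: sqr_ge0.
  have b0 : 0 <= c2 * (q x * dot x x).
    by apply: mulr_ge0 => //; apply: mulr_ge0 => //; exact: dotxx_ge0.
  have [qx|qx] := leP (L ^+ 2 / 4 * T) (q x); last by lra.
  have [ux|ux] := leP (dot x u ^+ 2) (D * dot u u); last first.
    have U0 : 0 < dot u u.
      rewrite dotxx_gt0; apply: contraTneq ux => ->.
      by rewrite !dot0r expr0n mulr0 ltxx.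
    have : q x <= c1 * (q x * dot x u ^+ 2).
      rewrite mulrCA ler_peMr// ler_pdivlMl ?mulr1 ?mulr_gt0//.
      exact: ltW.
    lra.
  have [xx|xx] := leP (dot x x) (D * n%:R).
    by exfalso; apply: (H x).
  have : q x <= c2 * (q x * dot x x).
    rewrite mulrCA ler_peMr// ler_pdivlMl ?mulr1 ?mulr_gt0//.
    exact: ltW.
  lra.
rewrite Eq bintD//; last 2 first.
  exact: bmeas_cst.
  by apply: bmeasD; exact: bmeasZ.
rewrite bint_cst// volK mulr1 bintD//; try exact: bmeasZ.
rewrite !bintZ//.
have LT : 0 < L ^+ 2 * T by rewrite mulr_gt0// exprn_gt0.
have h1 : c1 * \int[lebesgue_rV n]_(x in K) (q x * dot x u ^+ 2) <= L ^+ 2 * T / 4.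
  apply: le_trans (ler_wpM2l c10 (Equ u)) _.
  have [->|u0] := eqVneq u 0; first by rewrite dot0l !mulr0 divr_ge0// ltW.
  rewrite le_eqVlt; apply/orP; left; apply/eqP; rewrite /c1 DE; field.
  by rewrite -dotxx_gt0 in u0; rewrite !gt_eqF.
have h2 : c2 * \int[lebesgue_rV n]_(x in K) (q x * dot x x) <= L ^+ 2 * T / 4.
  apply: le_trans (ler_wpM2l c20 Eqx) _.
  rewrite le_eqVlt; apply/orP; left; apply/eqP; rewrite /c2 DE; field.
  by rewrite !gt_eqF.
lra.
Qed.

End isotropic.

(** * Determinants *)

Section completed_determinants.
Context {R : realType} {n : nat}.
Implicit Types s t : seq 'rV[R]_n.

Definition rows_mx s : 'M[R]_n := \matrix_(i < n) nth 0 s i.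

(* Sum of det ^ 2 over all completions of s by m vectors of the standard basis. *)
Fixpoint compl_det2 (m : nat) s : R :=
  if m is m'.+1 then \sum_(l < n) compl_det2 m' (rcons s (delta_mx ord0 l))
  else \det (rows_mx s) ^+ 2.

Lemma compl_det2_ge0 m s : 0 <= compl_det2 m s.
Proof.
elim: m s => [|m IHm] s /=; first exact: sqr_ge0.
by apply: sumr_ge0 => l _; exact: IHm.
Qed.

Lemma compl_det2_sum_sqr m s t : (size s + size t + m).+1 = n ->
  exists thetas : seq 'rV[R]_n, forall x,
    compl_det2 m (s ++ x :: t) = \sum_(theta <- thetas) dot x theta ^+ 2.
Proof.
elim: m s t => [|m IHm] s t stn.
  have sn : (size s < n)%N by rewrite -[X in (_ < X)%N]stn addn0 ltnS leq_addr.
  pose k := Ordinal sn.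
  exists [:: \row_j cofactor (rows_mx (s ++ 0 :: t)) k j] => x.
  rewrite big_seq1 /= (expand_det_row _ k) /dot; congr (_ ^+ 2).
  apply: eq_bigr => j _; rewrite !mxE; congr (_ * _).
    by rewrite nth_cat ltnn subnn.
  rewrite /cofactor; congr (_ * \det _); apply/matrixP => i l; rewrite !mxE.
  have : lift k i != k by rewrite eq_sym neq_lift.
  rewrite -val_eqE /=; set i' := bump _ _ => ik.
  rewrite !nth_cat; case: ltnP => // si.
  by case E : (i' - size s)%N => //; move: E ik => /eqP; rewrite subn_eq0 eqn_leq si andbT => ->.
have /choice[f fP] : forall l : 'I_n, exists thetas : seq 'rV[R]_n, forall x,
    compl_det2 m (s ++ x :: rcons t (delta_mx ord0 l)) =
    \sum_(theta <- thetas) dot x theta ^+ 2.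
  by move=> l; apply: IHm; rewrite size_rcons addnS addSn -addnS; exact: stn.
exists (flatten [seq f l | l <- index_enum 'I_n]) => x.
rewrite big_flatten big_map /=; apply: eq_bigr => l _.
by rewrite rcons_cat rcons_cons fP.
Qed.

Lemma compl_det2_basis m (ls : seq 'I_n) : uniq ls -> (size ls + m)%N = n ->
  m`!%:R <= compl_det2 m [seq delta_mx ord0 l | l <- ls].
Proof.
elim: m ls => [|m IHm] ls uls sls.
  rewrite addn0 in sls; move/eqP: sls => sls.
  pose T := Tuple sls.
  have inj : injective (tnth T) by apply/tuple_uniqP.
  rewrite /=; have -> : rows_mx [seq delta_mx ord0 l | l <- ls] = perm_mx (perm inj) :> 'M[R]_n.
    apply/matrixP => i j; rewrite !mxE permE.
    rewrite (nth_map i); last by rewrite (eqP sls).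
    by rewrite (tnth_nth i) mxE eqxx /= eq_sym.
  by rewrite /= det_perm fact0 -exprM mulnC exprM sqrrN expr1n expr1n.
have -> /= : (m.+1)`!%:R = \sum_(l < n | l \notin ls) (m`!%:R : R).
  rewrite sumr_const factS natrM mulr_natl; congr (_ *+ _).
  have := cardC (mem ls); rewrite card_ord (card_uniqP uls) => lsC.
  apply: (@addnI (size ls)); rewrite sls -[LHS]lsC; congr addn.
rewrite [leRHS](bigID (fun l => l \notin ls)) /=.
rewrite -[leLHS]addr0 lerD//; last by apply: sumr_ge0 => l _; exact: compl_det2_ge0.
apply: ler_sum => l lls; rewrite -map_rcons.
by apply: IHm; rewrite ?rcons_uniq ?lls// size_rcons addSnnS.
Qed.

Lemma compl_det2_rcons m s : (size s + m).+1 = n ->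
  exists2 thetas : seq 'rV[R]_n,
   forall x, compl_det2 m (rcons s x) = \sum_(theta <- thetas) dot x theta ^+ 2 &
   compl_det2 m.+1 s = \sum_(theta <- thetas) dot theta theta.
Proof.
move=> sm; have [|thetas E] := @compl_det2_sum_sqr m s [::]; first by rewrite addn0.
exists thetas => [x|]; first by rewrite -cats1.
rewrite /=; under eq_bigr do rewrite -cats1 E.
rewrite exchange_big; apply: eq_bigr => theta _.
by apply: eq_bigr => l _; rewrite dotC dot_delta expr2.
Qed.

End completed_determinants.

Lemma isotropic_points (R : realType) n (K : set 'rV[R]_n) (L : R) :
  (0 < n)%N -> isotropic_with K L -> 
  exists s : seq 'rV[R]_n, [/\ size s = n, forall x, x \in s -> K x,
    (L ^+ 2 / 4) ^+ n * n`!%:R <= \det (rows_mx s) ^+ 2 &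
    dot (\sum_(x <- s) x) (\sum_(x <- s) x) <= 4032 * L ^+ 2 * n%:R ^+ 2].
Proof.
move=> n0 [[cK convK _] volK baryK L0 isoK].
pose S (s : seq 'rV[R]_n) := \sum_(x <- s) x.
have [C C0 CE] : exists2 C : R, 0 < C & C ^+ 2 = 576 * L ^+ 2.
  exists (24 * L); first by rewrite mulr_gt0.
  by rewrite exprMn; congr (_ * _); ring.
suff H k : (k <= n)%N -> exists s : seq 'rV[R]_n, [/\ size s = k, forall x, x \in s -> K x,
    (L ^+ 2 / 4) ^+ k * n`!%:R <= compl_det2 (n - k) s &
    dot (S s) (S s) <= 7 * C ^+ 2 * n%:R * k%:R].
  have [s [ss sK]] := H n (leqnn n); rewrite subnn /= => sdet sS.
  exists s; split; [exact: ss|exact: sK|exact: sdet|].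
  rewrite (_ : 4032 * L ^+ 2 = 7 * C ^+ 2); last by rewrite CE; ring.
  by rewrite (expr2 n%:R) mulrA.
elim: k => [_|k IHk kn].
  exists [::]; split; [by []|by []| |by rewrite /S big_nil dot0l mulr0].
  by rewrite expr0 mul1r subn0; exact: (@compl_det2_basis R n n [::]).
have [s [ss sK sdet sS]] := IHk (ltnW kn).
have [|thetas E1 E2] := @compl_det2_rcons R n (n - k.+1) s.
  by rewrite ss -addnS -subSn// subSS subnKC// ltnW.
rewrite -subSn// subSS in E2.
have T0 : 0 < \sum_(theta <- thetas) dot theta theta.
  rewrite -E2 (lt_le_trans _ sdet)// mulr_gt0 ?ltr0n ?fact_gt0// exprn_gt0//.
  by rewrite divr_gt0// exprn_gt0.
have [x [Kx qx xS xx]] := isotropic_good_point n0 cK convK volK L0 isoK (S s) T0.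
rewrite -CE in xS xx.
exists (rcons s x); split.
- by rewrite size_rcons ss.
- by move=> y; rewrite mem_rcons inE => /predU1P[->//|/sK].
- rewrite E1; apply: le_trans qx; rewrite exprS -mulrA ler_wpM2l//.
    by rewrite divr_ge0// sqr_ge0.
  by rewrite -E2.
- rewrite /S -cats1 big_cat big_seq1 /= -/(S s).
  rewrite dotDl !dotDr (dotC (S s) x).
  have kn' : k%:R <= n%:R :> R by rewrite ler_nat ltnW.
  have nR : 0 < n%:R :> R by rewrite ltr0n.
  have C20 : 0 < C ^+ 2 by rewrite exprn_gt0.
  have : dot x (S s) <= C * (3 * C * n%:R).
    apply: le_trans (ler_norm _) _.
    rewrite -ler_sqr ?nnegrE ?mulr_ge0 ?(ltW C0) ?(ltW nR)// real_normK ?num_real//.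
    apply: le_trans xS _; rewrite exprMn.
    rewrite ler_pM2l//; apply: le_trans sS _.
    apply: (@le_trans _ _ (7 * C ^+ 2 * n%:R * n%:R)).
      by rewrite ler_pM2l// !mulr_gt0.
    rewrite !exprMn -mulrA -expr2 ler_pM2r ?exprn_gt0// ler_pM2r//.
    by rewrite -natrX ler_nat.
  rewrite -[k.+1%:R]natr1 mulrDr mulr1 => h.
  rewrite (_ : C * (3 * C * n%:R) = 3 * (C ^+ 2 * n%:R)) in h; last by ring.
  by lra.
Qed.

(** * Simplices *)

Lemma dot_sumr (R : realType) n (I : Type) (r : seq I) (F : I -> 'rV[R]_n) x :
  dot x (\sum_(i <- r) F i) = \sum_(i <- r) dot x (F i).
Proof.
elim/big_ind2 : _ => [|a b c d <- <-|//]; first by rewrite dot0r.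
by rewrite dotDr.
Qed.

Lemma convex_set_sum (R : realType) n (M : set 'rV[R]_n) m
    (w : 'I_m -> 'rV[R]_n) (a : 'I_m -> R) :
  convex_set M -> (forall i, M (w i)) -> (forall i, 0 <= a i) ->
  \sum_i a i = 1 -> M (\sum_i a i *: w i).
Proof.
move=> cM; elim: m w a => [|m IHm] w a Mw a0.
  by rewrite big_ord0 => /eqP; rewrite eq_sym oner_eq0.
rewrite !big_ord_recl => a1.
have [a01|a01] := eqVneq (a ord0) 1.
  have /eqP : \sum_(i < m) a (lift ord0 i) = 0 by lra.
  rewrite psumr_eq0// => /allP h; rewrite big1.
    by rewrite addr0 a01 scale1r.
  move=> i _; have := h i; rewrite mem_index_enum => /(_ isT) /eqP ->.
  by rewrite scale0r.
set s := \sum_(i < m) a (lift ord0 i) in a1.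
have s0 : 0 <= s by apply: sumr_ge0.
have s1 : s = 1 - a ord0 by lra.
have sn0 : s != 0 by rewrite s1 subr_eq0 eq_sym.
have -> : \sum_(i < m) a (lift ord0 i) *: w (lift ord0 i) =
    (1 - a ord0) *: \sum_(i < m) (s^-1 * a (lift ord0 i)) *: w (lift ord0 i).
  rewrite -s1 scaler_sumr; apply: eq_bigr => i _.
  by rewrite scalerA mulrA mulfV// mul1r.
apply: convex_setP => //; last by rewrite a0/=; lra.
apply: IHm => //.
  by move=> i; rewrite mulr_ge0// invr_ge0.
by rewrite -mulr_sumr -/s mulVf.
Qed.

Section change_of_variables.
Context {R : realType} {n : nat}.
Implicit Types (A : set 'rV[R]_n) (T : 'M[R]_n).

Let integral_indicT A : measurable A ->
  (\int[lebesgue_rV n]_x (\1_A x : R)%:E = lebesgue_rV n A)%E.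
Proof. by move=> mA; rewrite integral_indic// setIT. Qed.

Let mindic A : measurable A ->
  measurable_fun [set: 'rV[R]_n] (fun x => (\1_A x : R)%:E).
Proof. by move=> mA; apply/measurable_EFinP; exact: measurable_indic. Qed.

Lemma lebesgue_rV_preimage_mulmx A T : T \in unitmx -> measurable A ->
  lebesgue_rV n [set x | A (x *m T)] = ((`|\det T|^-1)%:E * lebesgue_rV n A)%E.
Proof.
move=> uT mA; rewrite -(integral_indicT mA) -(ge0_integral_mulmx uT (mindic mA)); last first.
  by move=> x; rewrite lee_fin.
rewrite -integral_indicT//.
by rewrite -[X in measurable X]setTI; exact: measurable_mulmxr.
Qed.

Lemma lebesgue_rV_preimage_addr A v : measurable A ->
  lebesgue_rV n [set x | A (x + v)] = lebesgue_rV n A.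
Proof.
move=> mA; rewrite -(integral_indicT mA) -(ge0_integral_rVD v (mindic mA)); last first.
  by move=> x; rewrite lee_fin.
rewrite -integral_indicT//.
by rewrite -[X in measurable X]setTI; exact: measurable_addrV.
Qed.

Lemma bint_mulmx (S : set 'rV[R]_n) T (f : 'rV[R]_n -> R) :
  compact S -> T \in unitmx -> `|\det T| = 1 -> (forall x, S (x *m T) <-> S x) ->
  bmeas S f ->
  \int[lebesgue_rV n]_(x in S) f (x *m T) = \int[lebesgue_rV n]_(x in S) f x.
Proof.
move=> cS uT dT ST bf.
have bT g : bmeas S g -> bmeas S (fun x => g (x *m T)).
  move=> [mg [M Mg]]; split; first by apply: (measurableT_comp mg); exact: measurable_mulmxr.
  by exists M => x /ST; exact: Mg.
wlog f0 : f bf / forall x, S x -> 0 <= f x.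
  move=> H; have [_ [M Mf]] := bf.
  have bfM : bmeas S (fun x => f x + M) by apply: bmeasD => //; exact: bmeas_cst.
  have := H _ bfM; rewrite !bintD//; try exact: bmeas_cst; last exact: bT.
  move=> H'; apply: (addIr (\int[lebesgue_rV n]_(x in S) M)); apply: H' => x /Mf.
  by rewrite ler_norml => /andP[h _]; rewrite -lerBlDr sub0r.
apply: EFin_inj; rewrite -!bint_patch//; last exact: bT.
transitivity (\int[lebesgue_rV n]_x ((f \_ S) (x *m T)%R)%:E)%E.
  apply: eq_integral => x _; congr (_%:E); rewrite !patchE.
  by congr (if _ then _ else _); apply/idP/idP; rewrite !inE => /ST.
rewrite (ge0_integral_mulmx (f := fun x => ((f \_ S) x)%:E))//.
- by rewrite dT invr1 mul1e.
- apply/measurable_EFinP; apply/(measurable_restrictT f (compact_measurable_rV cS)).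
  by apply: measurable_funTS; case: bf.
- by move=> x; rewrite lee_fin patchE; case: ifPn => // /set_mem /f0.
Qed.

End change_of_variables.

Section simplex.
Context {R : realType} {n : nat} (v : 'I_n.+1 -> 'rV[R]_n).

Definition edge_mx : 'M[R]_n := \matrix_(i < n) (v (lift ord0 i) - v ord0).

Hypothesis uV : edge_mx \in unitmx.

Let z (x : 'rV[R]_n) : 'rV[R]_n := (x - v ord0) *m invmx edge_mx.

Lemma affinely_independent_edge : affinely_independent v.
Proof.
move=> a a0 av.
have E : (\row_i a (lift ord0 i)) *m edge_mx = 0.
  rewrite mulmx_sum_row; under eq_bigr do rewrite rowK mxE scalerBr.
  rewrite sumrB -scaler_suml.
  move: a0 av; rewrite !big_ord_recl => a0 av.
  have -> : \sum_(i < n) a (lift ord0 i) = - a ord0 by apply/eqP; rewrite -addr_eq0 addrC a0.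
  by rewrite scaleNr opprK addrC.
have a'0 : \row_i a (lift ord0 i) = 0 by rewrite -[LHS](mulmxK uV) E mul0mx.
have al i : a (lift ord0 i) = 0 by have := congr1 (fun r : 'rV_n => r ord0 i) a'0; rewrite !mxE.
move=> i; have [j ->|->] := unliftP ord0 i; first exact: al.
by move: a0; rewrite big_ord_recl big1 ?addr0.
Qed.

Lemma bary_coordE x : x = v ord0 + \sum_(i < n) z x ord0 i *: (v (lift ord0 i) - v ord0).
Proof.
have := mulmx_sum_row (z x) edge_mx; under eq_bigr do rewrite rowK.
by move=> <-; rewrite mulmxKV// addrC subrK.
Qed.

Lemma bary_coord0 : z (v ord0) = 0.
Proof. by rewrite /z subrr mul0mx. Qed.

Lemma bary_coord_lift i : z (v (lift ord0 i)) = delta_mx ord0 i.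
Proof.
rewrite /z; have -> : v (lift ord0 i) - v ord0 = row i edge_mx by rewrite rowK.
by rewrite -row_mul mulmxV// row1.
Qed.

Lemma bary_coord_conv x y t i :
  z (t *: x + (1 - t) *: y) ord0 i = t * z x ord0 i + (1 - t) * z y ord0 i.
Proof.
have -> : z (t *: x + (1 - t) *: y) = t *: z x + (1 - t) *: z y.
  rewrite /z !scalemxAl -mulmxDl; congr (_ *m _).
  by apply/rowP => j; rewrite !mxE; ring.
by move: (z x) (z y) => a b; rewrite !mxE.
Qed.

Lemma conv_hull_edge : conv_hull (range v) =
  [set x | (forall i, 0 <= z x ord0 i) /\ \sum_i z x ord0 i <= 1].
Proof.
apply/seteqP; split.
  apply: smallest_sub.
    move=> x y t; rewrite !inE/= => -[x0 x1] [y0 y1].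
    have -> : conv t x y = t%:num *: x + (1 - t%:num) *: y by [].
    have t0 : 0 <= t%:num by [].
    have t1 : t%:num <= 1 by [].
    move: (t%:num) t0 t1 => s s0 s1.
    have s1' : 0 <= 1 - s by rewrite subr_ge0.
    split => [i|].
      by rewrite bary_coord_conv; apply: addr_ge0; exact: mulr_ge0.
    under eq_bigr do rewrite bary_coord_conv.
    rewrite big_split/= -!mulr_sumr.
    by have := ler_wpM2l s0 x1; have := ler_wpM2l s1' y1; lra.
  move=> _ [i _ <-] /=; have [j ->|->] := unliftP ord0 i.
    rewrite bary_coord_lift; split => [k|]; first by rewrite mxE ler0n.
    rewrite (bigD1 j)//= big1 ?mxE ?eqxx ?addr0// => k kj.
    by rewrite mxE (negbTE kj) andbF.
  rewrite bary_coord0; split => [k|]; first by rewrite mxE.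
  by rewrite big1// => k _; rewrite mxE.
move=> x /= [x0 x1] M [cM vM].
pose a (i : 'I_n.+1) := if unlift ord0 i is Some j then z x ord0 j else 1 - \sum_i z x ord0 i.
have -> : x = \sum_i a i *: v i.
  rewrite big_ord_recl /a unlift_none [LHS]bary_coordE.
  under eq_bigr do rewrite scalerBr.
  rewrite sumrB -scaler_suml scalerBl scale1r addrA [RHS]addrAC.
  congr (_ + _); congr (_ + _); apply: eq_bigr => i _.
  by rewrite liftK.
apply: convex_set_sum => //.
- by move=> i; apply: vM; exists i.
- by move=> i; rewrite /a; case: unliftP => // _; rewrite subr_ge0.
- rewrite big_ord_recl /a unlift_none.
  rewrite [X in _ + X](eq_bigr (fun i => z x ord0 i)); first by rewrite subrK.
  by move=> i _; rewrite liftK.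
Qed.

Lemma closed_simplex : closed (conv_hull (range v)).
Proof.
rewrite conv_hull_edge.
pose u i : 'rV[R]_n := \row_j invmx edge_mx j i.
have zE x i : z x ord0 i = dot x (u i) - dot (v ord0) (u i).
  by rewrite -dotBl /z mxE; apply: eq_bigr => j _; rewrite !mxE.
have cd w c : closed [set x : 'rV[R]_n | c <= dot x w].
  rewrite (_ : [set x | _] = (fun x : 'rV[R]_n => dot x w) @^-1` [set r | c <= r])//.
  apply: preimage_closed; last exact: closed_ge.
  by move=> x _; exact: continuous_dot.
rewrite (_ : [set x | _] =
  (\bigcap_(i in [set: 'I_n]) [set x : 'rV[R]_n | dot (v ord0) (u i) <= dot x (u i)]) `&`
  [set x : 'rV[R]_n | dot (v ord0) (- \sum_i u i) - 1 <= dot x (- \sum_i u i)]).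
  by apply: closedI => //; apply: closed_bigI => i _; exact: cd.
have dots x : \sum_i z x ord0 i = dot x (\sum_i u i) - dot (v ord0) (\sum_i u i).
  by under eq_bigr do rewrite zE; rewrite sumrB -!dot_sumr.
apply/seteqP; split => x /=; rewrite dots !dotNr.
  move=> [x0 x1]; split; last by lra.
  by move=> i _ /=; have := x0 i; rewrite zE subr_ge0.
move=> [x0 x1]; split; last by lra.
by move=> i; rewrite zE subr_ge0; exact: x0.
Qed.

(* The simplex contains an affine image of the cube [0, 1/n]^n. *)
Lemma lebesgue_simplex_ge : (0 < n)%N ->
  ((`|\det edge_mx| * n%:R^-1 ^+ n)%:E <= lebesgue_rV n (conv_hull (range v)))%E.
Proof.
move=> n0.
pose I (i : 'I_n) : set (measurableTypeR R) := `[0, n%:R^-1]%classic.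
pose B := [set x : 'rV[R]_n | forall i, I i (x ord0 i)].
have mI i : measurable (I i) by exact: measurable_itv.
have mB : measurable B by exact: measurable_box.
have nR : 0 < n%:R :> R by rewrite ltr0n.
have LB : lebesgue_rV n B = (n%:R^-1 ^+ n)%:E.
  rewrite lebesgue_rV_prod//.
  under eq_bigr do rewrite lebesgue_measure_itv/= lte_fin invr_gt0 nR -EFinB subr0.
  by rewrite prodEFin prodr_const card_ord.
pose C := [set x | B (z x)].
have mC' : measurable [set x | B (x *m invmx edge_mx)].
  by rewrite -[X in measurable X]setTI; exact: measurable_mulmxr.
have mC : measurable C.
  by rewrite -[X in measurable X]setTI; exact: (measurable_addrV (- v ord0) measurableT mC').
have -> : ((`|\det edge_mx| * n%:R^-1 ^+ n)%:E = lebesgue_rV n C)%E.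
  rewrite (@lebesgue_rV_preimage_addr _ _ [set x | B (x *m invmx edge_mx)])//.
  rewrite lebesgue_rV_preimage_mulmx ?unitmx_inv// LB -EFinM det_inv.
  by rewrite normrV -?unitmxE// invrK.
apply: le_measure; rewrite ?inE//.
  by apply: closed_measurable_rV; exact: closed_simplex.
rewrite conv_hull_edge => x Cx; split => [i|].
  by have := Cx i; rewrite /I /= in_itv/= => /andP[].
apply: (@le_trans _ _ (\sum_(i < n) n%:R^-1)).
  by apply: ler_sum => i _; have := Cx i; rewrite /I /= in_itv/= => /andP[].
by rewrite sumr_const card_ord -[leLHS]mulr_natl mulfV// gt_eqF.
Qed.

End simplex.

Lemma dot_mulmxl (R : realType) n (x u : 'rV[R]_n) (T : 'M[R]_n) :
  dot (x *m T) u = dot x (u *m T^T).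
Proof.
have E (y w : 'rV[R]_n) : dot y w = (y *m w^T) ord0 ord0.
  by rewrite mxE; apply: eq_bigr => i _; rewrite mxE.
by rewrite !E trmx_mul trmxK mulmxA.
Qed.

Lemma dot_inj (R : realType) n (x y : 'rV[R]_n) :
  (forall u, dot x u = dot y u) -> x = y.
Proof. by move=> xy; apply/rowP => i; rewrite -!dot_delta. Qed.

Lemma conv_hull_mulmx (R : realType) n (A : set 'rV[R]_n) (T : 'M[R]_n) x :
  (forall y, A y -> A (y *m T)) -> conv_hull A x -> conv_hull A (x *m T).
Proof.
move=> AT Ax M [cM AM]; apply: (Ax [set x | M (x *m T)]); split.
  move=> y z t; rewrite !inE/= => My Mz.
  have -> : conv t y z *m T = t%:num *: (y *m T) + (1 - t%:num) *: (z *m T).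
    by rewrite !scalemxAl -mulmxDl.
  by apply: convex_setP => //; apply/andP; split.
by move=> y /AT /AM.
Qed.

Section simplex_barycenter.
Context {R : realType} {n : nat} (v : 'I_n.+1 -> 'rV[R]_n).
Hypotheses (uV : edge_mx v \in unitmx) (v0 : \sum_i v i = 0).
Local Notation S := (conv_hull (range v)).

Definition vertex_perm_mx (s : {perm 'I_n.+1}) : 'M[R]_n :=
  invmx (edge_mx v) *m edge_mx (v \o s).

Lemma vertex_perm_mxE s k : v k *m vertex_perm_mx s = v (s k).
Proof.
have nE : n.+1%:R != 0 :> R by rewrite pnatr_eq0.
have E i : (v (lift ord0 i) - v ord0) *m vertex_perm_mx s = v (s (lift ord0 i)) - v (s ord0).
  have -> : v (lift ord0 i) - v ord0 = row i (edge_mx v) by rewrite rowK.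
  by rewrite mulmxA -row_mul mulmxV// row1 -rowE rowK.
have Es (w : 'I_n.+1 -> 'rV[R]_n) : \sum_i w i = 0 ->
    n.+1%:R *: w ord0 = - \sum_(i < n) (w (lift ord0 i) - w ord0).
  rewrite big_ord_recl => /eqP; rewrite addrC addr_eq0 => /eqP w0.
  by rewrite sumrB w0 sumr_const card_ord opprB opprK scaler_nat mulrSr.
have E0 : v ord0 *m vertex_perm_mx s = v (s ord0).
  apply: (scalerI nE); rewrite scalemxAl (Es v v0) (Es (v \o s)); last first.
    by rewrite -(reindex_inj (@perm_inj _ s) (P := xpredT) (F := v)).
  by rewrite mulNmx mulmx_suml; congr (- _); apply: eq_bigr => i _.
have [j ->|->//] := unliftP ord0 k.
by have := E j; rewrite mulmxBl E0 => /addIr.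
Qed.

Lemma vintegral_vertex_perm i j : compact S ->
  vintegral S *m vertex_perm_mx (tperm i j) = vintegral S.
Proof.
move=> cS; set T := vertex_perm_mx _.
have TT : T *m T = 1%:M.
  have : edge_mx v *m (T *m T) = edge_mx v.
    apply/row_matrixP => k; rewrite row_mul !rowK mulmxA !mulmxBl.
    by rewrite !vertex_perm_mxE !tpermK.
  by move=> /(congr1 (mulmx (invmx (edge_mx v)))); rewrite mulKmx// mulVmx.
have uT : T \in unitmx by case: (mulmx1_unit TT).
have dT : `|\det T| = 1.
  have : `|\det T| ^+ 2 = 1 by rewrite -normrX expr2 -det_mulmx TT det1 normr1.
  by move=> /eqP; rewrite sqrp_eq1// => /eqP.
have ST x : S x -> S (x *m T).
  by apply: conv_hull_mulmx => _ [k _ <-]; exists (tperm i j k); rewrite ?vertex_perm_mxE.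
apply: dot_inj => u; rewrite dot_mulmxl -!(bint_dot cS).
rewrite -[RHS](bint_mulmx cS uT dT _ (bmeas_dot cS u)); last first.
  by move=> x; split => [/ST|/ST//]; rewrite -mulmxA TT mulmx1.
by apply: eq_Rintegral => x _; rewrite dot_mulmxl.
Qed.

(* The center of mass is fixed by all transpositions of the vertices. *)
Lemma barycenter_simplex : compact S -> barycenter S = 0.
Proof.
move=> cS; rewrite /barycenter; suff -> : vintegral S = 0 by rewrite scaler0.
set w := vintegral S.
pose y := w *m invmx (edge_mx v).
pose c k := if unlift ord0 k is Some i then y ord0 i else - \sum_i y ord0 i.
have c0 : \sum_k c k = 0.
  rewrite big_ord_recl /c unlift_none addrC.
  by rewrite [X in X - _](eq_bigr (fun i => y ord0 i)) ?subrr// => i _; rewrite liftK.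
have wE : w = \sum_k c k *: v k.
  rewrite big_ord_recl /c unlift_none.
  rewrite [X in _ + X](eq_bigr (fun i => y ord0 i *: v (lift ord0 i))); last first.
    by move=> i _; rewrite liftK.
  have := mulmx_sum_row y (edge_mx v); rewrite mulmxKV// => ->.
  rewrite [LHS](eq_bigr (fun i => y ord0 i *: v (lift ord0 i) - y ord0 i *: v ord0)).
    by rewrite sumrB -scaler_suml scaleNr addrC.
  by move=> i _; rewrite rowK scalerBr.
have cc k : c ord0 = c k.
  pose t := tperm ord0 k.
  have := vintegral_vertex_perm ord0 k cS; rewrite -/w => wT.
  have wt : w = \sum_i c (t i) *: v i.
    rewrite -wT [in LHS]wE mulmx_suml (reindex_inj (@perm_inj _ t)) /=.
    apply: eq_bigr => i _.
    by rewrite -scalemxAl vertex_perm_mxE tpermK.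
  apply/eqP; rewrite -subr_eq0; apply/eqP.
  have := affinely_independent_edge uV (a := fun i => c i - c (t i)).
  rewrite sumrB -(reindex_inj (@perm_inj _ t) (P := xpredT) (F := c)) subrr.
  move=> /(_ erefl); under eq_bigr do rewrite scalerBl.
  rewrite sumrB -wt -wE subrr => /(_ erefl ord0).
  by rewrite tpermL.
have c00 : c ord0 = 0.
  move: c0; rewrite (eq_bigr (fun=> c ord0)) => [|i _]; last by rewrite -cc.
  rewrite sumr_const card_ord => /eqP; rewrite mulrn_eq0/= => /eqP //.
by rewrite wE big1// => k _; rewrite -cc c00 scale0r.
Qed.

End simplex_barycenter.

Lemma centered_simplex (R : realType) n (K : set 'rV[R]_n)
    (y : 'I_n.+1 -> 'rV[R]_n) (e : R) :
  (0 < n)%N -> compact K -> convex_set K -> (forall i, K (y i)) ->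
  edge_mx y \in unitmx -> 0 < e ->
  K (- e *: (n.+1%:R^-1 *: \sum_i y i)) ->
  exists S, [/\ simplex S, S `<=` K, barycenter S = 0 &
    `|\det (edge_mx y)| * (e / (1 + e) / n%:R) ^+ n <= vol S].
Proof.
move=> n0 cK convK Ky uY e0; set p := - e *: _ => Kp.
have e1 : 1 + e != 0 by rewrite gt_eqF// addr_gt0.
pose s := (1 + e)^-1.
have s1 : 1 - s = e / (1 + e) by rewrite /s; field.
have s01 : 0 <= s <= 1.
  rewrite invr_ge0 ltW ?addr_gt0//=.
  by rewrite invf_le1 ?addr_gt0// lerDl ltW.
pose v i := s *: p + (1 - s) *: y i.
have Kv i : K (v i) by exact: convex_setP.
have Ev : edge_mx v = (1 - s) *: edge_mx y.
  by apply/matrixP => i j; rewrite !mxE; ring.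
have dV : \det (edge_mx v) = (1 - s) ^+ n * \det (edge_mx y) by rewrite Ev detZ.
have uV : edge_mx v \in unitmx.
  rewrite unitmxE dV unitrM -unitmxE uY andbT unitfE expf_neq0// s1.
  by rewrite mulf_neq0 ?invr_eq0// gt_eqF.
have nE : n.+1%:R != 0 :> R by rewrite pnatr_eq0.
have v0 : \sum_i v i = 0.
  rewrite big_split/= -scaler_sumr sumr_const card_ord -scaler_nat.
  rewrite /p !scalerA -scaler_sumr -scalerDl; apply/eqP; rewrite scaler_eq0; apply/orP; left.
  by apply/eqP; rewrite s1 /s; move: (n.+1%:R) nE => N NE; field; rewrite NE e1.
have vK : conv_hull (range v) `<=` K.
  by apply: smallest_sub => // _ [i _ <-].
have cS : compact (conv_hull (range v)).
  exact: (subclosed_compact (closed_simplex uV) cK vK).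
exists (conv_hull (range v)); split => //.
- by exists v => //; exact: affinely_independent_edge.
- exact: barycenter_simplex.
have := lebesgue_simplex_ge uV n0.
have fS : lebesgue_rV n (conv_hull (range v)) \is a fin_num.
  by rewrite ge0_fin_numE// compact_lebesgue_lty.
rewrite -(fineK fS) lee_fin; apply: le_trans; rewrite dV normrM s1.
rewrite ger0_norm; last by rewrite exprn_ge0// divr_ge0 ?addr_ge0 ?ltW.
by rewrite expr_div_n exprVn mulrCA mulrA.
Qed.

(** * The theorem *)

Lemma expnn_le_fact n : (n ^ n <= 4 ^ n * n`!)%N.
Proof.
apply: (@leq_trans ((n + n) ^_ n)).
  rewrite ffact_prod -[X in (_ ^ X)%N]card_ord -prod_nat_const.
  by apply: leq_prod => i _; rewrite -addnBA ?leq_addr// ltnW.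
rewrite -bin_ffact leq_mul2r; apply/orP; right.
have -> : (4 ^ n = 2 ^ (n + n))%N by rewrite addnn -mul2n expnM.
rewrite -[2%N]/(1 + 1)%N expnDn (bigD1 (inord n))//= inordK ?ltnS ?leq_addr//.
by rewrite !exp1n !muln1 leq_addr.
Qed.

Section body.
Context {R : realType} {n : nat} (K : set 'rV[R]_n).
Hypotheses (n0 : (0 < n)%N) (cK : compact K) (convK : convex_set K).

Definition cube (z : 'rV[R]_n) (r : R) :=
  [set x : 'rV[R]_n | forall i, `[z ord0 i - r, z ord0 i + r]%classic (x ord0 i)].

Lemma measurable_cube z r : measurable (cube z r).
Proof.
pose I (i : 'I_n) : set (measurableTypeR R) := `[z ord0 i - r, z ord0 i + r]%classic.
by apply: (@measurable_box _ _ I) => i; rewrite /I; exact: measurable_itv.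
Qed.

Lemma lebesgue_cube z r : 0 < r -> lebesgue_rV n (cube z r) = ((r + r) ^+ n)%:E.
Proof.
move=> r0.
pose I (i : 'I_n) : set (measurableTypeR R) := `[z ord0 i - r, z ord0 i + r]%classic.
rewrite [LHS](@lebesgue_rV_prod _ _ I); last by move=> i; rewrite /I; exact: measurable_itv.
rewrite (eq_bigr (fun=> (r + r)%:E)); first by rewrite prodEFin prodr_const card_ord.
move=> i _; rewrite /I lebesgue_measure_itv/= lte_fin ifT; last by lra.
by rewrite -EFinB; congr (_%:E); ring.
Qed.

Lemma opp_interior_body (z : 'rV[R]_n) :
  K° z -> barycenter K = 0 -> exists2 e, 0 < e & K (- e *: z).
Proof.
move=> /nbhs_ballP[d /= d0 zdK] bK.
pose r := d / 8.
have r0 : 0 < r by rewrite divr_gt0.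
have dr : d = 8 * r by rewrite /r mulrC divfK.
pose B := cube z r.
have dil y : B y -> K (z + 4 *: (y - z)).
  move=> By; apply: zdK; split => // i j; have -> : i = ord0 by exact: ord1.
  have := By j; rewrite /= in_itv/= /ball/= !mxE => /andP[h1 h2].
  rewrite ltr_norml; apply/andP; split; lra.
have BK : B `<=` K.
  move=> y By; apply: zdK; split => // i j; have -> : i = ord0 by exact: ord1.
  have := By j; rewrite /= in_itv/= /ball/= => /andP[h1 h2].
  rewrite ltr_norml; apply/andP; split; lra.
have zB : B z by move=> i; rewrite /= in_itv/=; apply/andP; split; lra.
have mB : measurable B by exact: measurable_cube.
have fK : lebesgue_rV n K \is a fin_num by rewrite ge0_fin_numE// compact_lebesgue_lty.
pose V := (r + r) ^+ n.
have V0 : 0 < V by rewrite exprn_gt0// addr_gt0.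
have VK : V <= vol K.
  rewrite -lee_fin /vol fineK// /V -(lebesgue_cube z r0).
  by apply: le_measure; rewrite ?inE//; exact: compact_measurable_rV.
have intB : \int[lebesgue_rV n]_(x in K) (\1_B x) = V.
  rewrite /Rintegral integral_indic//; last exact: compact_measurable_rV.
  have -> : B `&` K = B by apply/setIidPl.
  exact: (congr1 fine (lebesgue_cube z r0)).
have vK0 : vintegral K = 0.
  have := bK; rewrite /barycenter => /eqP; rewrite scaler_eq0 invr_eq0.
  by rewrite gt_eqF ?(lt_le_trans V0 VK)//= => /eqP.
pose e := V / (2 * vol K + V).
have D0 : 0 < 2 * vol K + V by lra.
have eD : e * (2 * vol K + V) = V by rewrite /e divfK// gt_eqF.
have e0 : 0 < e by rewrite divr_gt0.
have e1 : e <= 1 by rewrite ler_pdivrMr//; lra.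
exists e => //; apply: contrapT => Kp.
have [theta Ht] := separation cK convK (ex_intro _ z (BK z zB)) Kp.
rewrite dotZl in Ht.
pose w := - dot z theta.
have w0 : 0 < w by have := Ht z (BK z zB); rewrite /w; nra.
have lB y : B y -> dot y theta <= - (w / 2).
  move=> /dil /Ht; rewrite dotDl dotZl dotBl.
  have -> : dot z theta = - w by rewrite /w opprK.
  have ew : e * w <= w by rewrite ler_piMl// ltW.
  by rewrite mulrNN => h; lra.
have : 0 <= e * w * vol K - w / 2 * V.
  rewrite -(dot0l theta) -[X in dot X _]vK0 -(bint_dot cK).
  rewrite -intB -(bint_cst cK) -bintZ//; last exact: bmeas_indic.
  rewrite -bintB//; [|exact: bmeas_cst|by apply: bmeasZ; exact: bmeas_indic].
  apply: bint_le => //; first exact: bmeas_dot.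
    by apply: bmeasB; [exact: bmeas_cst|apply: bmeasZ; exact: bmeas_indic].
  move=> x Kx; rewrite indicE; case: (boolP (x \in B)) => xB.
    rewrite mulr1; have := lB x (set_mem xB); have : 0 < e * w by rewrite mulr_gt0.
    lra.
  by rewrite mulr0 subr0; have := Ht x Kx; rewrite /w; lra.
have : 0 < w * (V / 2 - e * vol K).
  rewrite mulr_gt0//.
  have : 0 < e * V by rewrite mulr_gt0.
  lra.
lra.
Qed.

(* Needed only when isotropic_constant K takes its default value 0. *)
Lemma exists_centered_simplex : K° !=set0 -> barycenter K = 0 ->
  exists S, [/\ simplex S, S `<=` K & barycenter S = 0].
Proof.
move=> [z /nbhs_ballP[d /= d0 zdK]] bK.
pose y (k : 'I_n.+1) : 'rV[R]_n :=
  if unlift ord0 k is Some i then z + (d / 2) *: delta_mx ord0 i else z.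
have yl i : y (lift ord0 i) = z + (d / 2) *: delta_mx ord0 i by rewrite /y liftK.
have y0 : y ord0 = z by rewrite /y unlift_none.
have d2 : 0 < d / 2 by rewrite divr_gt0.
have Yd : edge_mx y = (d / 2)%:M.
  apply/matrixP => i j; rewrite !mxE yl y0 !mxE eqxx /= eq_sym addrC addKr.
  by rewrite mulr_natr.
have uY : edge_mx y \in unitmx.
  by rewrite Yd unitmxE det_scalar unitrX// unitfE gt_eqF.
have yb k : ball z d (y k).
  have [i ->|->] := unliftP ord0 k; last by rewrite y0; exact: ballxx.
  split => // i' j; have -> : i' = ord0 by exact: ord1.
  rewrite yl /ball/= !mxE opprD addrA subrr sub0r normrN.
  rewrite normrM (gtr0_norm d2); rewrite normr_nat; case: (_ && _); rewrite ?mulr1 ?mulr0; lra.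
pose b := n.+1%:R^-1 *: \sum_i y i.
have nE : 0 < n.+1%:R :> R by rewrite ltr0n.
have bb : ball z d b.
  split => // i j; have -> : i = ord0 by exact: ord1.
  rewrite /ball/= /b mxE summxE.
  rewrite (_ : _ - _ = n.+1%:R^-1 * \sum_k (z ord0 j - y k ord0 j)); last first.
    rewrite sumrB sumr_const card_ord mulrBr -[z _ _ *+ n.+1]mulr_natl.
    by rewrite mulKf // gt_eqF.
  rewrite normrM gtr0_norm ?invr_gt0// ltr_pdivrMl//.
  apply: le_lt_trans (ler_norm_sum _ _ _) _.
  rewrite mulr_natl -[X in _ < _ *+ X]card_ord -sumr_const.
  apply: ltr_sum; first by apply/hasP; exists ord0; rewrite ?mem_index_enum.
  by move=> k _; have [_ /(_ ord0 j)] := yb k.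
have [e e0 Ke] : exists2 e, 0 < e & K (- e *: b).
  apply: opp_interior_body => //.
  apply: filterS zdK _; apply: open_nbhs_nbhs; split => //.
  exact: ball_open.
have Ky k : K (y k) by exact/zdK/yb.
have [S [? ? ? _]] := centered_simplex n0 cK convK Ky uY e0 Ke.
by exists S.
Qed.

End body.

Lemma isotropic_centered_simplex (R : realType) n (K : set 'rV[R]_n)
    (T : 'M[R]_n) (L e : R) :
  (0 < n)%N -> convex_body K -> T \in unitmx ->
  isotropic_with [set x *m T | x in K] L ->
  0 < e -> e ^+ 2 * 4032 * 68 ^+ 2 < 1 ->
  exists S, [/\ simplex S, S `<=` K, barycenter S = 0 &
    e / (1 + e) / 4 * L / Num.sqrt n%:R <= (vol S / vol K) `^ (n%:R^-1)].
Proof.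
move=> n0 [cK convK _] uT iso e0 e1; set K' := [set x *m T | x in K] in iso.
have [[cK' convK' _] volK' bK' L0 isoK'] := iso.
have K'E x : K' x <-> K (x *m invmx T).
  split=> [[y Ky <-]|Kx]; first by rewrite mulmxK.
  by exists (x *m invmx T) => //; rewrite mulmxKV.
have dT0 : 0 < `|\det T| by rewrite normr_gt0 -unitfE -unitmxE.
have vK : vol K = `|\det T|^-1.
  have : vol K' = `|\det T| * vol K.
    rewrite /vol (_ : K' = [set x | K (x *m invmx T)]); last first.
      by apply/seteqP; split => x /K'E.
    rewrite lebesgue_rV_preimage_mulmx ?unitmx_inv//; last exact: compact_measurable_rV.
    rewrite fineM//; last by rewrite ge0_fin_numE// compact_lebesgue_lty.
    by rewrite /= det_inv normrV -?unitmxE// invrK.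
  have dTn0 : `|\det T| != 0 by rewrite gt_eqF.
  by rewrite volK' => h; apply: (mulfI dTn0); rewrite -h mulfV.
have [s [ss sK' sdet sS]] := isotropic_points n0 iso.
have K'0 : K' 0.
  apply: (isotropic_contains_ball cK' convK' volK' bK' L0 isoK').
  by rewrite dot0l exprn_gt0// divr_gt0.
pose y (k : 'I_n.+1) : 'rV[R]_n :=
  if unlift ord0 k is Some i then nth 0 s i *m invmx T else 0.
have yl i : y (lift ord0 i) = nth 0 s i *m invmx T by rewrite /y liftK.
have y0 : y ord0 = 0 by rewrite /y unlift_none.
have Ky k : K (y k).
  have [i ->|->] := unliftP ord0 k; last by rewrite y0 -(mul0mx _ (invmx T)); exact/K'E.
  by rewrite yl; apply/K'E/sK'; rewrite mem_nth// ss.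
have Ey : edge_mx y = rows_mx s *m invmx T.
  by apply/row_matrixP => i; rewrite row_mul !rowK yl y0 subr0.
have Sy : \sum_k y k = (\sum_(x <- s) x) *m invmx T.
  rewrite big_ord_recl y0 add0r (eq_bigr _ (fun i _ => yl i)) -mulmx_suml.
  by rewrite [in RHS](big_nth 0) ss big_mkord.
have nR : 0 < n%:R :> R by rewrite ltr0n.
have L20 : 0 < L ^+ 2 by rewrite exprn_gt0.
have det0 : 0 < \det (rows_mx s) ^+ 2.
  apply: lt_le_trans sdet; rewrite mulr_gt0 ?ltr0n ?fact_gt0// exprn_gt0//.
  by rewrite divr_gt0.
have detn0 : \det (rows_mx s) != 0 by rewrite -sqrf_eq0 gt_eqF.
have uY : edge_mx y \in unitmx.
  by rewrite Ey unitmx_mul unitmx_inv uT andbT unitmxE unitfE.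
have Kb : K (- e *: (n.+1%:R^-1 *: \sum_k y k)).
  rewrite Sy !scalemxAl; apply/K'E.
  apply: (isotropic_contains_ball cK' convK' volK' bK' L0 isoK').
  rewrite !dotZl !dotZr; set D := dot _ _ in sS *.
  have N0 : 0 < n.+1%:R :> R by rewrite ltr0n.
  have Nn : n%:R <= n.+1%:R :> R by rewrite ler_nat.
  have [Q Q0 QE] : exists2 Q : R, 0 <= Q & Q = 4032 * L ^+ 2.
    exists (4032 * L ^+ 2); last by [].
    by apply: mulr_ge0; [rewrite ler0n|exact: ltW].
  rewrite -QE in sS.
  move: (n.+1%:R) N0 Nn => N N0 Nn.
  have D1 : D <= Q * N ^+ 2.
    apply: le_trans sS _; rewrite ler_wpM2l//.
    by rewrite lerXn2r// nnegrE ltW.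
  rewrite (_ : _ * (_ * _) = e ^+ 2 / N ^+ 2 * D); last by field; rewrite gt_eqF.
  have eN : 0 < e ^+ 2 / N ^+ 2 by rewrite divr_gt0 ?exprn_gt0.
  apply: (@le_lt_trans _ _ (e ^+ 2 / N ^+ 2 * (Q * N ^+ 2))); first by rewrite ler_pM2l.
  rewrite (_ : e ^+ 2 / N ^+ 2 * _ = e ^+ 2 * Q); last by field; rewrite gt_eqF.
  have L68 : 0 < 68 ^+ 2 :> R by rewrite exprn_gt0// ltr0n.
  rewrite expr_div_n (ltr_pdivlMr _ _ L68) QE -[X in _ < X]mul1r.
  rewrite (_ : e ^+ 2 * _ * _ = e ^+ 2 * 4032 * 68 ^+ 2 * L ^+ 2); last by ring.
  by rewrite (ltr_pM2r L20).
have [S [simS SK bS volS]] := centered_simplex n0 cK convK Ky uY e0 Kb.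
exists S; split => //.
set q := e / (1 + e) in volS *.
have q0 : 0 < q by rewrite divr_gt0// addr_gt0.
have sn0 : 0 < Num.sqrt n%:R :> R by rewrite sqrtr_gt0.
set t := q / 4 * L / Num.sqrt n%:R.
have t0 : 0 < t by rewrite divr_gt0// mulr_gt0// divr_gt0.
suff tn : t ^+ n <= vol S / vol K.
  have -> : t = (t ^+ n) `^ n%:R^-1.
    by rewrite -powR_mulrn ?(ltW t0)// -powRrM mulfV ?powRr1 ?(ltW t0)// gt_eqF.
  apply: ge0_ler_powR; rewrite ?nnegrE ?invr_ge0 ?exprn_ge0 ?(ltW t0)//.
  by apply: le_trans tn; rewrite exprn_ge0// ltW.
have : `|\det (rows_mx s)| * (q / n%:R) ^+ n <= vol S / vol K.
  rewrite vK invrK; apply: le_trans (ler_wpM2r (ltW dT0) volS).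
  rewrite Ey det_mulmx normrM det_inv normrV -?unitmxE//.
  rewrite le_eqVlt; apply/orP; left; apply/eqP.
  move: (`|\det T|) dT0 (`|\det (rows_mx s)|) ((q / n%:R) ^+ n) => d d0 a c.
  by field; rewrite gt_eqF.
apply: le_trans.
rewrite -ler_sqr ?nnegrE ?exprn_ge0 ?(ltW t0)//; last first.
  by rewrite mulr_ge0// exprn_ge0// divr_ge0 ?ltW.
rewrite [leRHS]exprMn real_normK ?num_real//.
apply: (@le_trans _ _ ((L ^+ 2 / 4) ^+ n * n`!%:R * ((q / n%:R) ^+ n) ^+ 2)); last first.
  by rewrite ler_wpM2r// sqr_ge0.
have nf : (n%:R / 4) ^+ n <= n`!%:R :> R.
  rewrite expr_div_n ler_pdivrMr ?exprn_gt0// mulrC -!natrX -natrM ler_nat.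
  exact: expnn_le_fact.
apply: (@le_trans _ _ ((L ^+ 2 / 4) ^+ n * (n%:R / 4) ^+ n * ((q / n%:R) ^+ n) ^+ 2)); last first.
  rewrite ler_wpM2r ?sqr_ge0// ler_wpM2l// exprn_ge0// divr_ge0// ltW//.
rewrite -![(_ ^+ n) ^+ 2]exprM ![(n * 2)%N]mulnC ![_ ^+ (2 * n)]exprM -!exprMn.
have -> // : t ^+ 2 = L ^+ 2 / 4 * (n%:R / 4) * (q / n%:R) ^+ 2.
have sq : Num.sqrt n%:R ^+ 2 = n%:R :> R by rewrite sqr_sqrtr// ltW.
rewrite /t expr_div_n sq; field.
by rewrite gt_eqF.
Qed.

Theorem mainTheorem4 (R : realType) :
  exists2 c : R, 0 < c &
    forall (n : nat) (K : set 'rV[R]_n), (1 <= n)%N ->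
      convex_body K -> barycenter K = 0 ->
      exists S : set 'rV[R]_n,
        [/\ simplex S, S `<=` K, barycenter S = 0 &
            c * isotropic_constant K / Num.sqrt n%:R
              <= (vol S / vol K) `^ (n%:R^-1)].
Proof.
pose e : R := 5000^-1.
have e0 : 0 < e by rewrite invr_gt0 ltr0n.
have e1 : e ^+ 2 * 4032 * 68 ^+ 2 < 1 by rewrite /e; lra.
exists (e / (1 + e) / 4); first by rewrite !divr_gt0// addr_gt0.
move=> n K n0 bodyK bK; rewrite /isotropic_constant.
case: xgetP => [L _ [T uT iso]|_].
  exact: (isotropic_centered_simplex n0 bodyK uT iso e0 e1).
have [cK convK K0] := bodyK.
have [S [? ? ?]] := exists_centered_simplex n0 cK convK K0 bK.
by exists S; split => //; rewrite mulr0 mul0r powR_ge0.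
Qed.
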